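(* Let $\lambda\in\mathbb{C}$ not be an eigenvalue of $L$ (operator and notation as defined in the context), and let $h\in L^2(-a,b)$. Then $$(\lambda-L)^{-1}\begin{bmatrix}h\\ 0\\ 0\end{bmatrix}=\begin{bmatrix}\mathfrak{G}_\lambda h\\ \mathbf f^1\\ \mathbf f^2\end{bmatrix},$$ where: if $\eta>0$: $\mathbf f^1=(\lambda I-[\gamma_i])^{-1}\boldsymbol\beta\,\Delta'\mathfrak{G}_\lambda h$ when $\lambda\ne\gamma_i$ for all $i$, and $\mathbf f^1=-\frac1{\beta_I}(\mathfrak{G}_\lambda h)(0^+)\,\mathbf e^I$ when $\lambda=\gamma_I$; if $\eta=0$: $\mathbf f^1=(\lambda I-[c_i])^{-1}\mathbf b\,(\mathfrak{G}_\lambda h)(0^+)$ when $\lambda\ne c_i$ for all $i$, and $\mathbf f^1=\frac1{b_I}(\Delta'\mathfrak{G}_\lambda h)\,\mathbf e^I$ when $\lambda=c_I$; if $\kappa>0$: $\mathbf f^2=(\lambda I-[\delta_j])^{-1}\boldsymbol\alpha\,\Delta\mathfrak{G}_\lambda h$ when $\lambda\ne\delta_j$ for all $j$, and $\mathbf f^2=\frac1{\alpha_J}(\mathfrak{G}_\lambda h)'(0^-)\,\mathbf e^J$ when $\lambda=\delta_J$; if $\kappa=0$: $\mathbf f^2=(\lambda I-[d_j])^{-1}\mathbf a\,(\mathfrak{G}_\lambda h)'(0^-)$ when $\lambda\ne d_j$ for all $j$, and $\mathbf f^2=-\frac1{a_J}(\Delta\mathfrak{G}_\lambda h)\,\mathbf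 e^J$ when $\lambda=d_J$. Here $\mathbf e^I$ (resp. $\mathbf e^J$) is the standard basis vector with $I$-th (resp. $J$-th) entry $1$ and all others $0$.
   Context: Let $a,b>0$, $q\in L^2(-a,b)$, $\alpha\in[0,\pi)$, $\beta\in(0,\pi]$, and $\ell y:=-y''+qy$. Let $N,M\in\mathbb{N}_0$ (empty sums are $0$), $\eta,\kappa\ge 0$, $\xi,\zeta\in\mathbb{R}$, real numbers $c_1<\dots<c_N$ and $d_1<\dots<d_M$, and $b_i>0$ ($i=1,\dots,N$), $a_j>0$ ($j=1,\dots,M$). Put $$\mu(\lambda)=-\Big(\lambda\eta-\xi-\sum_{i=1}^N\frac{b_i^2}{\lambda-c_i}\Big),\qquad \nu(\lambda)=\lambda\kappa+\zeta-\sum_{j=1}^M\frac{a_j^2}{\lambda-d_j}.$$ If $\eta>0$ write $\frac1{\mu(\lambda)}=\sigma-\sum_{i=1}^{N'}\frac{\beta_i^2}{\lambda-\gamma_i}$ with $N'\in\mathbb{N}$, $\gamma_1<\dots<\gamma_{N'}$, $\beta_i>0$; if $\kappa>0$ write $\frac1{\nu(\lambda)}=\tau+\sum_{j=1}^{M'}\frac{\alpha_j^2}{\lambda-\delta_j}$ with $M'\in\mathbb{N}$, $\delta_1<\dots<\delta_{M'}$, $\alpha_j>0$ (such partial fraction expansions exist). Bold letters denote vectors: $\boldsymbol\beta=(\beta_i)$, $\boldsymbol\alpha=(\alpha_j)$, $\mathbf b=(b_i)$, $\mathbf a=(a_j)$; $[\gamma_i],[\delta_j],[c_i],[d_j]$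 denote the corresponding diagonal matrices. For a function $y$ on $(-a,0)\cup(0,b)$ write $y(0^\pm),y'(0^\pm)$ for one-sided limits at $0$, $\Delta y=y(0^+)-y(0^-)$, $\Delta' y=y'(0^+)-y'(0^-)$. Operator $L$: let $\mathcal H=L^2(-a,b)\oplus\mathbb{C}^{N^*}\oplus\mathbb{C}^{M^*}$, where $N^*=N'$ if $\eta>0$, $N^*=N$ if $\eta=0$, $M^*=M'$ if $\kappa>0$, $M^*=M$ if $\kappa=0$, with inner product $\langle Y,Z\rangle=\int_{-a}^b y\bar z\,dx+\langle\mathbf y^1,\mathbf z^1\rangle+\langle\mathbf y^2,\mathbf z^2\rangle$ (Euclidean inner products on the last two components). For $Y=(y,\mathbf y^1,\mathbf y^2)$ set $LY=(\ell y,[LY]_1,[LY]_2)$, where $[LY]_1=\boldsymbol\beta\Delta' y+[\gamma_i]\mathbf y^1$ if $\eta>0$, $[LY]_1=\mathbf b\,y(0^+)+[c_i]\mathbf y^1$ if $\eta=0$; $[LY]_2=\boldsymbol\alpha\Delta y+[\delta_j]\mathbf y^2$ if $\kappa>0$, $[LY]_2=\mathbf a\,y'(0^-)+[d_j]\mathbf y^2$ if $\kappa=0$. The domain $\mathcal D(L)$ consists of all $Y\in\mathcal H$ such that $y_1:=y|_{(-a,0)}$ has $y_1,y_1',\ell y_1\in L^2(-a,0)$ and $y(-a)\cos\alpha=y'(-a)\sin\alpha$; $y_2:=y|_{(0,b)}$ has $y_2,y_2',\ell y_2\in L^2(0,b)$ and $y(b)\cos\beta=y'(b)\sin\beta$;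 $-y(0^+)+\sigma\Delta' y-\langle\mathbf y^1,\boldsymbol\beta\rangle=0$ if $\eta>0$, $\ \Delta' y-\xi y(0^+)-\langle\mathbf y^1,\mathbf b\rangle=0$ if $\eta=0$; $y'(0^-)-\tau\Delta y-\langle\mathbf y^2,\boldsymbol\alpha\rangle=0$ if $\kappa>0$, $\ -\Delta y+\zeta y'(0^-)-\langle\mathbf y^2,\mathbf a\rangle=0$ if $\kappa=0$. The eigenvalues of $L$ coincide with those of the boundary value problem: $\ell y=\lambda y$ on $(-a,0)$ and $(0,b)$, the boundary conditions $y(-a)\cos\alpha=y'(-a)\sin\alpha$ and $y(b)\cos\beta=y'(b)\sin\beta$, and $y(0^+)\mu(\lambda)=\Delta' y$, $y'(0^-)\nu(\lambda)=\Delta y$ (the first read as $y(0^+)=0$ at a pole of $\mu$, the second as $y'(0^-)=0$ at a pole of $\nu$). Green's operator $\mathfrak G_\lambda$: $(\mathfrak G_\lambda h)(x)=\int_{-a}^bG(x,t;\lambda)h(t)\,dt$ for $\lambda$ not an eigenvalue, where $G$ is defined as follows. (i) If $\lambda$ is not a pole of $\mu$ or $\nu$: let $T=\begin{bmatrix}1&\nu(\lambda)\\ \mu(\lambda)&1+\mu(\lambda)\nu(\lambda)\end{bmatrix}$. Let $u$ solve $\ell u=\lambda u$ on $[-a,0)$ with $u(-a)=\sin\alpha$, $u'(-a)=\cos\alpha$, extended to $(0,b]$ as the solution with $(u(0^+),u'(0^+))^{\mathsf T}=T(u(0^-),u'(0^-))^{\mathsf T}$; let $v$ solve $\ell v=\lambda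 v$ on $(0,b]$ with $v(b)=\sin\beta$, $v'(b)=\cos\beta$, extended to $[-a,0)$ as the solution with $(v(0^-),v'(0^-))^{\mathsf T}=T^{-1}(v(0^+),v'(0^+))^{\mathsf T}$. The Wronskian $\psi=uv'-u'v$ is constant, and $G(x,t;\lambda)=u(x)v(t)/\psi$ for $x<t$, $G(x,t;\lambda)=u(t)v(x)/\psi$ for $t<x$. (ii) If $\lambda$ is a pole of $\mu$ or $\nu$: $G(x,t;\lambda)=g^-(x,t;\lambda)$ for $x,t\in[-a,0)$, $G=g^+(x,t;\lambda)$ for $x,t\in(0,b]$, and $G=0$ otherwise. Here $g^-$ is the Green's function (the kernel of the solution operator $h\mapsto g$ of $(\lambda-\ell)g=h$) on $[-a,0]$ with boundary conditions $g(-a)\cos\alpha=g'(-a)\sin\alpha$ and $g'(0^-)\nu(\lambda)=-g(0^-)$ if $\lambda$ is not a pole of $\nu$, $g'(0^-)=0$ if $\lambda$ is a pole of $\nu$; and $g^+$ is the Green's function (in the same sense) on $[0,b]$ with boundary conditions $g(b)\cos\beta=g'(b)\sin\beta$ and $g(0^+)\mu(\lambda)=g'(0^+)$ if $\lambda$ is not a pole of $\mu$, $g(0^+)=0$ if $\lambda$ is a pole of $\mu$. *)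

(* Defs.v *)
From HB Require Import structures.
From mathcomp Require Import all_boot all_order all_algebra.
From mathcomp Require Import all_classical all_reals all_analysis.
From mathcomp.real_closed Require Import complex.

Set Implicit Arguments.
Unset Strict Implicit.
Unset Printing Implicit Defensive.
Import Order.TTheory GRing.Theory Num.Theory.
Import numFieldNormedType.Exports.

Local Open Scope classical_set_scope.
Local Open Scope ring_scope.
Local Open Scope complex_scope.

Section ComplexCalculus.
Context {R : realType}.
Implicit Types (f g y : R -> R[i]) (s t x : R).

Definition reF f : R -> R := fun x => complex.Re (f x).
Definition imF f : R -> R := fun x => complex.Im (f x).

Definition intC (D : set R) f : R[i] :=
  (\int[lebesgue_measure]_(x in D) reF f x)
    +i* (\int[lebesgue_measure]_(x in D) imF f x).

Definition integrableC (D : set R) f : Prop :=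
  lebesgue_measure.-integrable D (EFin \o reF f) /\
  lebesgue_measure.-integrable D (EFin \o imF f).

(* Every class of the complex space L^2(D) has a representative which is Borel
   measurable; [L2] is the set of those, and [L2ae] is the set of all
   representatives.  The latter is needed for expressions such as [ell q y]
   below, which are meaningful only almost everywhere. *)
Definition L2 (D : set R) f : Prop :=
  (reF f \_ D \in Lfun (@lebesgue_measure R) 2%:E) /\
  (imF f \_ D \in Lfun (@lebesgue_measure R) 2%:E).

Definition eqae (D : set R) f g : Prop :=
  {ae @lebesgue_measure R, forall x, D x -> f x = g x}.

Definition L2ae (D : set R) f : Prop := exists2 g, L2 D g & eqae D f g.

Definition cderiv f : R -> R[i] := fun x => derive1 (reF f) x +i* derive1 (imF f) x.

(* One-sided limits f(x^+) and f(x^-); they are meaningful only if the limits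
   exist, which is the case for the functions of class [W2] and their
   derivatives. *)
Definition limp f x : R[i] :=
  lim (reF f t @[t --> x^'+]) +i* lim (imF f t @[t --> x^'+]).
Definition limm f x : R[i] :=
  lim (reF f t @[t --> x^'-]) +i* lim (imF f t @[t --> x^'-]).

(* Absolute continuity on ]s, t[, up to the end points. *)
Definition abs_cont s t f : Prop :=
  exists2 g, integrableC `]s, t[ g &
    forall x1 x2, s < x1 -> x1 <= x2 -> x2 < t ->
      f x2 - f x1 = intC `[x1, x2] g.

(* The functions to which -y'' + q y applies: differentiable on ]s, t[, with
   an absolutely continuous derivative (hence y'' exists almost everywhere). *)
Definition W2 s t y : Prop :=
  (forall x, s < x < t -> derivable (reF y) x 1 /\ derivable (imF y) x 1) /\
  abs_cont s t (cderiv y).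

Definition ell (q y : R -> R[i]) : R -> R[i] :=
  fun x => - cderiv (cderiv y) x + q x * y x.

Definition jump y : R[i] := limp y 0 - limm y 0.
Definition djump y : R[i] := limp (cderiv y) 0 - limm (cderiv y) 0.

Definition dotC n (u v : 'cV[R[i]]_n) : R[i] := \sum_i u i 0 * (v i 0)^*.
Definition vecC n (w : 'I_n -> R) : 'cV[R[i]]_n := \col_i (w i)%:C.
Definition diagC n (p : 'I_n -> R) : 'M[R[i]]_n := diag_mx (\row_i (p i)%:C).

End ComplexCalculus.

(* The boundary angles are [bcl] (at -a) and [bcr] (at b).
   The data [sigma, gamma, beta] and [tau, delta, alpha] of the expansions of
   1/mu and 1/nu are constrained (and used) only if [eta], resp. [kappa], is
   positive. *)
Record problem (R : realType) := Problem {
  pa : R;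
  pb : R;
  pq : R -> R[i];
  bcl : R;
  bcr : R;
  eta : R;
  xi : R;
  dimN : nat;
  cpole : 'I_dimN -> R;
  bres : 'I_dimN -> R;
  kappa : R;
  zeta : R;
  dimM : nat;
  dpole : 'I_dimM -> R;
  ares : 'I_dimM -> R;
  sigma : R;
  dimN' : nat;
  gamma : 'I_dimN' -> R;
  beta : 'I_dimN' -> R;
  tau : R;
  dimM' : nat;
  delta : 'I_dimM' -> R;
  alpha : 'I_dimM' -> R
}.

Section Problem.
Context {R : realType}.
Variable P : problem R.
Implicit Types (lam z : R[i]) (y u v h : R -> R[i]) (G K : R -> R -> R[i]).

Definition mu lam : R[i] :=
  - (lam * (eta P)%:C - (xi P)%:C
     - \sum_(i < dimN P) ((bres i)%:C) ^+ 2 / (lam - (cpole i)%:C)).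

Definition nu lam : R[i] :=
  lam * (kappa P)%:C + (zeta P)%:C
     - \sum_(j < dimM P) ((ares j)%:C) ^+ 2 / (lam - (dpole j)%:C).

Definition mu_pole lam : Prop := exists i : 'I_(dimN P), lam = (cpole i)%:C.
Definition nu_pole lam : Prop := exists j : 'I_(dimM P), lam = (dpole j)%:C.

Definition increasing_positive n (p w : 'I_n -> R) : Prop :=
  (forall i j : 'I_n, (i < j)%N -> p i < p j) /\ (forall i, 0 < w i).

(* Equality of the rational functions 1/mu and 1/nu with their partial
   fraction expansions: equality wherever both sides are defined. *)
Definition inv_mu_expansion : Prop :=
  increasing_positive (@gamma R P) (@beta R P) /\
  forall z, ~ mu_pole z -> mu z != 0 -> (forall i : 'I_(dimN' P), z != (gamma i)%:C) ->
    (mu z)^-1 =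
    (sigma P)%:C - \sum_(i < dimN' P) ((beta i)%:C) ^+ 2 / (z - (gamma i)%:C).

Definition inv_nu_expansion : Prop :=
  increasing_positive (@delta R P) (@alpha R P) /\
  forall z, ~ nu_pole z -> nu z != 0 -> (forall j : 'I_(dimM' P), z != (delta j)%:C) ->
    (nu z)^-1 =
    (tau P)%:C + \sum_(j < dimM' P) ((alpha j)%:C) ^+ 2 / (z - (delta j)%:C).

Record standing_assumptions : Prop := StandingAssumptions {
  a_gt0 : 0 < pa P;
  b_gt0 : 0 < pb P;
  q_L2 : L2 `](- pa P), (pb P)[ (pq P);
  bcl_range : 0 <= bcl P < pi;
  bcr_range : 0 < bcr P <= pi;
  eta_ge0 : 0 <= eta P;
  kappa_ge0 : 0 <= kappa P;
  mu_data : increasing_positive (@cpole R P) (@bres R P);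
  nu_data : increasing_positive (@dpole R P) (@ares R P);
  inv_mu_data : 0 < eta P -> inv_mu_expansion;
  inv_nu_data : 0 < kappa P -> inv_nu_expansion
}.

Definition Nstar : nat := if 0 < eta P then dimN' P else dimN P.
Definition Mstar : nat := if 0 < kappa P then dimM' P else dimM P.

(* [gamma] if eta > 0 and [cpole] if eta = 0; similarly below. *)
Definition node1 : 'I_Nstar -> R :=
  if 0 < eta P as e return 'I_(if e then dimN' P else dimN P) -> R
  then @gamma R P else @cpole R P.
Definition weight1 : 'I_Nstar -> R :=
  if 0 < eta P as e return 'I_(if e then dimN' P else dimN P) -> R
  then @beta R P else @bres R P.
Definition node2 : 'I_Mstar -> R :=
  if 0 < kappa P as e return 'I_(if e then dimM' P else dimM P) -> R
  then @delta R P else @dpole R P.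
Definition weight2 : 'I_Mstar -> R :=
  if 0 < kappa P as e return 'I_(if e then dimM' P else dimM P) -> R
  then @alpha R P else @ares R P.

(* Representatives of the elements of the Hilbert space: the function
   component is a function on R of which only the restriction to ]-a, b[
   modulo null sets matters (see [eqH]), and it is required to be square
   integrable in [dom]. *)
Definition H : Type := ((R -> R[i]^o) * 'cV[R[i]]_Nstar * 'cV[R[i]]_Mstar)%type.

Definition eqH (Y Z : H) : Prop :=
  [/\ eqae `](- pa P), (pb P)[ Y.1.1 Z.1.1, Y.1.2 = Z.1.2 & Y.2 = Z.2].

Definition bc_left y : Prop :=
  limp y (- pa P) * (cos (bcl P))%:C = limp (cderiv y) (- pa P) * (sin (bcl P))%:C.
Definition bc_right y : Prop :=
  limm y (pb P) * (cos (bcr P))%:C = limm (cderiv y) (pb P) * (sin (bcr P))%:C.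

Definition maxdom s t y : Prop :=
  [/\ W2 s t y, L2 `]s, t[ y, L2 `]s, t[ (cderiv y) & L2ae `]s, t[ (ell (pq P) y)].

(* The domain of L; a class belongs to it if it has a (then essentially unique)
   representative of class [W2] on both sides of 0, to which the pointwise
   formulas of [opL] apply. *)
Definition dom (Y : H) : Prop :=
  let y := Y.1.1 in
  [/\ L2 `](- pa P), (pb P)[ y,
      maxdom (- pa P) 0 y /\ bc_left y,
      maxdom 0 (pb P) y /\ bc_right y,
      (if 0 < eta P
       then - limp y 0 + (sigma P)%:C * djump y - dotC Y.1.2 (vecC weight1) = 0
       else djump y - (xi P)%:C * limp y 0 - dotC Y.1.2 (vecC weight1) = 0)
    & (if 0 < kappa P
       then limm (cderiv y) 0 - (tau P)%:C * jump y
              - dotC Y.2 (vecC weight2) = 0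
       else - jump y + (zeta P)%:C * limm (cderiv y) 0
              - dotC Y.2 (vecC weight2) = 0)].

Definition opL (Y : H) : H :=
  let y := Y.1.1 in
  (ell (pq P) y,
   (if 0 < eta P then djump y else limp y 0) *: vecC weight1
     + diagC node1 *m Y.1.2,
   (if 0 < kappa P then jump y else limm (cderiv y) 0) *: vecC weight2
     + diagC node2 *m Y.2).

Definition eigenvalueL lam : Prop :=
  exists Y : H, [/\ dom Y, ~ eqH Y 0 & eqH (opL Y) (lam *: Y)].

(* Y = (lam - L)^-1 F *)
Definition is_resolvent lam (F Y : H) : Prop :=
  [/\ dom Y, eqH (lam *: Y - opL Y) F
    & forall Z, dom Z -> eqH (lam *: Z - opL Z) F -> eqH Z Y].

Definition solves lam s t y : Prop :=
  W2 s t y /\ eqae `]s, t[ (ell (pq P) y) (fun x => lam * y x).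

Definition transfer lam : 'M[R[i]]_(1 + 1) :=
  block_mx 1%:M (nu lam)%:M (mu lam)%:M (1 + mu lam * nu lam)%:M.

Definition jetp y : 'cV[R[i]]_(1 + 1) :=
  col_mx (limp y 0)%:M (limp (cderiv y) 0)%:M.
Definition jetm y : 'cV[R[i]]_(1 + 1) :=
  col_mx (limm y 0)%:M (limm (cderiv y) 0)%:M.

Definition is_u lam u : Prop :=
  [/\ solves lam (- pa P) 0 u,
      limp u (- pa P) = (sin (bcl P))%:C,
      limp (cderiv u) (- pa P) = (cos (bcl P))%:C,
      solves lam 0 (pb P) u
    & jetp u = transfer lam *m jetm u].

Definition is_v lam v : Prop :=
  [/\ solves lam 0 (pb P) v,
      limm v (pb P) = (sin (bcr P))%:C,
      limm (cderiv v) (pb P) = (cos (bcr P))%:C,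
      solves lam (- pa P) 0 v
    & jetm v = invmx (transfer lam) *m jetp v].

(* The Wronskian u v' - u' v is constant on ]-a, 0[ and ]0, b[ together (the
   transfer matrix has determinant 1); psi is its value at 0^-. *)
Definition wronskian u v : R[i] :=
  limm u 0 * limm (cderiv v) 0 - limm (cderiv u) 0 * limm v 0.

(* [K] is the kernel on ]s, t[ of the solution operator h |-> g of
   (lam - ell) g = h with the boundary conditions [bc]. *)
Definition is_green_kernel lam s t (bc : (R -> R[i]) -> Prop) K : Prop :=
  forall h, L2 `]s, t[ h ->
    let g := fun x => intC `]s, t[ (fun r => K x r * h r) in
    [/\ forall x, s < x < t -> integrableC `]s, t[ (fun r => K x r * h r),
        W2 s t g,
        eqae `]s, t[ (fun x => lam * g x - ell (pq P) g x) h
      & bc g].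

Definition bc_minus lam (g : R -> R[i]) : Prop :=
  [/\ bc_left g,
      ~ nu_pole lam -> limm (cderiv g) 0 * nu lam = - limm g 0
    & nu_pole lam -> limm (cderiv g) 0 = 0].

Definition bc_plus lam (g : R -> R[i]) : Prop :=
  [/\ bc_right g,
      ~ mu_pole lam -> limp g 0 * mu lam = limp (cderiv g) 0
    & mu_pole lam -> limp g 0 = 0].

Definition punctured : set R := [set x | - pa P < x < 0 \/ 0 < x < pb P].

(* The values on the diagonal and outside of [punctured] are irrelevant. *)
Definition is_green lam G : Prop :=
  (~ mu_pole lam -> ~ nu_pole lam ->
     exists u v, [/\ is_u lam u, is_v lam v &
       forall x t, punctured x -> punctured t ->
         (x < t -> G x t = u x * v t / wronskian u v) /\
         (t < x -> G x t = u t * v x / wronskian u v)]) /\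
  (mu_pole lam \/ nu_pole lam ->
     exists gm gp,
       [/\ is_green_kernel lam (- pa P) 0 (bc_minus lam) gm,
           is_green_kernel lam 0 (pb P) (bc_plus lam) gp &
       forall x t, punctured x -> punctured t ->
         G x t = if (x < 0) && (t < 0) then gm x t
                 else if (0 < x) && (0 < t) then gp x t else 0]).

Definition greenop G h : R -> R[i] :=
  fun x => intC `](- pa P), (pb P)[ (fun t => G x t * h t).

(* (lam I - [p])^-1 w s if lam differs from all the p_i,
   and (r / w_k) e^k if lam = p_k. *)
Definition resolvent_vec n (p w : 'I_n -> R) lam (s r : R[i]) : 'cV[R[i]]_n :=
  if [pick k | lam == (p k)%:C] is Some k
  then (r / (w k)%:C) *: delta_mx k 0
  else invmx (lam%:M - diagC p) *m (s *: vecC w).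

End Problem.

Arguments node1 {R} P.
Arguments weight1 {R} P.
Arguments node2 {R} P.
Arguments weight2 {R} P.

(* Main.v *)
Require Import Defs.
From mathcomp Require Import all_boot all_order all_algebra.
From mathcomp Require Import all_classical all_reals all_analysis.
From mathcomp.real_closed Require Import complex.
From mathcomp Require Import measurable_realfun ring lra.

(** Let g be the image of h under Green's operator.  The theorem comes down to
    four facts.

    The function g solves the boundary value problem with right-hand side h: it
    satisfies (lam - ell) g = h on both sides of 0, the two boundary conditions
    and the conditions that link the jumps of g and g' at 0 to mu and nu
    ([green_bvp]).  When lam is not a pole, g is given on each side of 0 by
    variation of parameters, g = k (v U + u V), where k is the inverse of the
    Wronskian and U, V are primitives of h u and - h v, and the jets of u and v
    on the two sides of 0 correspond under the transfer matrix, which has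
    determinant 1.  When lam is a pole, the problem decouples at 0 and the
    kernels on the two sides provide these properties directly.

    A solution of the boundary value problem lifts to an element of the domain of
    L that solves the resolvent equation ([sol_in_H_resolvent]).  On the finite
    components this is algebra: solving the diagonal system turns the scalar
    product in the domain condition into a partial fraction sum, which is mu, nu
    or the reciprocal of one of them.  For the reciprocals one needs the identity
    also at poles of mu and at nodes gamma_i, where the given expansion of 1/mu is
    not a statement about values; it becomes one after clearing denominators,
    since polynomials that agree off a finite set are equal ([pf_inv_jump]).

    The Wronskian of u and v does not vanish when lam is not an eigenvalue.  It is
    constant, so if it vanishes then it vanishes at -a, which says that v fulfils
    the left boundary condition; then v is a nonzero solution of the homogeneous
    problem and its lift is an eigenvector ([wronskian_neq0]).

    The solution of the resolvent equation is unique because a difference of two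
    solutions would be an eigenvector ([resolvent_unique]).

    The coefficient q and the function h are only square integrable, so second
    derivatives exist only almost everywhere and the classical calculus does not
    apply.  Everything is expressed by pairs of a function and an integrable
    density of which it is a primitive.  Three facts on such pairs suffice: the
    product rule, which is Fubini's theorem on a triangle ([primitiveM]), almost
    everywhere differentiability, which is Lebesgue's differentiation theorem
    ([primitive_ae_is_derive]), and differentiability everywhere if the density is
    continuous ([primitive_continuous_is_derive]). *)

Set Implicit Arguments.
Unset Strict Implicit.
Unset Printing Implicit Defensive.
Import Order.TTheory GRing.Theory Num.Theory.
Import numFieldNormedType.Exports.

Local Open Scope classical_set_scope.
Local Open Scope ring_scope.

(** * Primitives of integrable functions on an interval *)

Section RealPrimitives.
Context {R : realType}.
Implicit Types (s t x c : R) (F G f g : R -> R).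
Notation mu := (@lebesgue_measure R).

Lemma ae_imply (P Q : R -> Prop) : (forall x, P x -> Q x) ->
  {ae mu, forall x, P x} -> {ae mu, forall x, Q x}.
Proof. by apply: filterS; exact: (ae_filter_ringOfSetsType mu). Qed.

Lemma ae_imply2 (P Q S : R -> Prop) : (forall x, P x -> Q x -> S x) ->
  {ae mu, forall x, P x} -> {ae mu, forall x, Q x} -> {ae mu, forall x, S x}.
Proof. by apply: filterS2; exact: (ae_filter_ringOfSetsType mu). Qed.

(** The density f determines the increments of F on ]s, t[, and its integrability
    up to the end points is what gives F one-sided limits there.  This is the real
    counterpart of [abs_cont] with the density made explicit. *)
Definition primitive s t F f : Prop :=
  mu.-integrable `]s, t[ (EFin \o f) /\
  forall x1 x2, s < x1 -> x1 <= x2 -> x2 < t ->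
    F x2 - F x1 = \int[mu]_(x in `[x1, x2]) f x.

Lemma integrable_itv_oo_cc s t f :
  mu.-integrable `]s, t[ (EFin \o f) -> mu.-integrable `[s, t] (EFin \o f).
Proof.
move=> /integrableP[mf ltf]; apply/integrableP; split.
  apply/emeasurable_fun_itv_bndo_bndcP/emeasurable_fun_itv_obnd_cbndP.
  exact: mf.
rewrite -integral_itv_bndo_bndc; last first.
  apply/emeasurable_fun_itv_obnd_cbndP.
  exact: measurableT_comp.
rewrite -integral_itv_obnd_cbnd //.
exact: measurableT_comp.
Qed.

Lemma Rintegral_itvD f s x1 x2 : s <= x1 -> x1 <= x2 ->
  mu.-integrable `[s, x2] (EFin \o f) ->
  \int[mu]_(x in `[s, x2]) f x =
  \int[mu]_(x in `[s, x1]) f x + \int[mu]_(x in `[x1, x2]) f x.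
Proof.
move=> sx1 x12 fi.
have -> : \int[mu]_(x in `[x1, x2]) f x = \int[mu]_(x in `]x1, x2]) f x.
  rewrite Rintegral_itv_obnd_cbnd //.
  apply: integrableS fi => //; apply: subset_itvr; rewrite bnd_simp.
  exact: sx1.
rewrite -(@Rintegral_itvB _ f (BLeft s) (BRight x2) x1) ?bnd_simp //.
by rewrite addrC subrK.
Qed.

(** Normal form based at the end point s, where F itself need not be defined:
    the constant is the limit F(s^+). *)
Lemma primitive_Rintegral s t F f : s < t -> primitive s t F f ->
  exists C, forall x, s < x < t -> F x = C + \int[mu]_(r in `[s, x]) f r.
Proof.
move=> st [/integrable_itv_oo_cc fi FE].
have sub x : x < t -> mu.-integrable `[s, x] (EFin \o f).
  move=> xt; apply: integrableS fi => //; apply: subset_itvl.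
  by rewrite bnd_simp ltW.
pose c := (s + t) / 2.
have sc : s < c by rewrite /c; lra.
have ct : c < t by rewrite /c; lra.
exists (F c - \int[mu]_(r in `[s, c]) f r) => x /andP[sx xt].
case: (leP c x) => [cx|/ltW xc].
- have := FE _ _ sc cx xt.
  have := Rintegral_itvD (ltW sc) cx (sub _ xt); lra.
- have := FE _ _ sx xc ct.
  have := Rintegral_itvD (ltW sx) xc (sub _ ct); lra.
Qed.

Lemma Rintegral_primitive s t F f C : mu.-integrable `]s, t[ (EFin \o f) ->
  (forall x, s < x < t -> F x = C + \int[mu]_(r in `[s, x]) f r) ->
  primitive s t F f.
Proof.
move=> fi FE; split => // x1 x2 sx1 x12 x2t.
have fi' : mu.-integrable `[s, x2] (EFin \o f).
  apply: integrableS (integrable_itv_oo_cc fi) => //; apply: subset_itvl.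
  by rewrite bnd_simp ltW.
rewrite !FE ?sx1 ?x2t ?(le_lt_trans x12) ?(lt_le_trans sx1) //.
have := Rintegral_itvD (ltW sx1) x12 fi'; lra.
Qed.

(** Boundedness and the existence of the limits at s and t all follow from
    compactness of [[s, t]] through this extension. *)
Lemma primitive_extension s t F f : s < t -> primitive s t F f ->
  exists2 E, {within `[s, t], continuous E} &
    forall x, s < x < t -> F x = E x.
Proof.
move=> st acF; have [C FE] := primitive_Rintegral st acF.
exists (fun x => C + \int[mu]_(r in `[s, x]) f r) => //.
have pc := parameterized_integral_continuous (ltW st)
  (integrable_itv_oo_cc acF.1).
by move=> x; apply: cvgD; [exact: cvg_cst|exact: pc].
Qed.

Lemma primitive_bounded s t F f : s < t -> primitive s t F f ->
  exists M, forall x, s < x < t -> `|F x| <= M.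
Proof.
move=> st /(primitive_extension st)[E cE FE].
have [M [Mr bM]] := compact_bounded (continuous_compact cE (@segment_compact _ s t)).
(* the bound holds for every number strictly above M *)
exists (`|M| + 1) => x xst; rewrite FE //.
apply: (bM (`|M| + 1)); first by rewrite (le_lt_trans (ler_norm M)) ?ltrDl.
exists x => //=; rewrite in_itv /=; move/andP: xst => [sx xt].
by rewrite !ltW.
Qed.

Lemma primitive_continuous s t F f x : primitive s t F f -> s < x < t -> {for x, continuous F}.
Proof.
move=> acF /[dup] xst /andP[sx xt].
have st : s < t := lt_trans sx xt.
have [E /(continuous_within_itvP _ st)[cE _ _] FE] := primitive_extension st acF.
have xin : x \in `]s, t[ by rewrite in_itv.
apply: (cvg_trans _ (_ : E y @[y --> x] --> F x)); last first.
  by rewrite FE //; exact: cE.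
apply: near_eq_cvg.
near=> y; rewrite FE //; apply/andP; split; near: y.
  exact: lt_nbhsr.
exact: lt_nbhsl.
Unshelve. all: by end_near. Qed.

Lemma primitive_measurable s t F f : primitive s t F f -> measurable_fun `]s, t[ F.
Proof.
move=> acF; apply: open_continuous_measurable_fun; first exact: interval_open.
by move=> x; rewrite inE /= in_itv /= => xst; exact: primitive_continuous acF xst.
Qed.

Lemma primitive_cvg_right s t F f : s < t -> primitive s t F f ->
  exists l : R, F x @[x --> s^'+] --> l.
Proof.
move=> st acF.
have [E /(continuous_within_itvP _ st)[_ cE _] FE] := primitive_extension st acF.
exists (E s); apply: (cvg_trans _ cE); apply: near_eq_cvg.
near=> y; rewrite FE //; apply/andP; split; near: y.
  exact: nbhs_right_gt.
exact: nbhs_right_lt.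
Unshelve. all: by end_near. Qed.

Lemma primitive_cvg_left s t F f : s < t -> primitive s t F f ->
  exists l : R, F x @[x --> t^'-] --> l.
Proof.
move=> st acF.
have [E /(continuous_within_itvP _ st)[_ _ cE] FE] := primitive_extension st acF.
exists (E t); apply: (cvg_trans _ cE); apply: near_eq_cvg.
near=> y; rewrite FE //; apply/andP; split; near: y.
  exact: nbhs_left_gt.
exact: nbhs_left_lt.
Unshelve. all: by end_near. Qed.

Lemma primitive_eq_fun s t F G f : (forall x, s < x < t -> F x = G x) ->
  primitive s t F f -> primitive s t G f.
Proof.
move=> FG [fi FE]; split => // x1 x2 sx1 x12 x2t.
by rewrite -!FG ?FE // ?sx1 ?x2t ?(le_lt_trans x12) ?(lt_le_trans sx1).
Qed.

Lemma primitive_eq_ae s t F f g : measurable_fun `]s, t[ g ->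
  {ae mu, forall x, x \in `]s, t[ -> f x = g x} ->
  primitive s t F f -> primitive s t F g.
Proof.
move=> mg fg [fi FE].
have gi : mu.-integrable `]s, t[ (EFin \o g).
  apply/integrableP; split; first exact/measurable_EFinP.
  move/integrableP : fi => [mf].
  rewrite (@ae_eq_integral _ _ _ mu `]s, t[ (abse \o (EFin \o f))
    (abse \o (EFin \o g))) //.
  - by do 2 apply: measurableT_comp => //.
  - exact: measurableT_comp.
  - by apply: ae_imply fg => x xE /= /xE ->.
split => // x1 x2 sx1 x12 x2t; rewrite FE //; congr fine.
have sub : `[x1, x2] `<=` `]s, t[.
  by apply: subset_itv; rewrite bnd_simp.
apply: ae_eq_integral => //.
- by apply: (measurable_int mu); apply: integrableS fi.
- by apply: (measurable_int mu); apply: integrableS gi.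
- by apply: ae_imply fg => x xE /sub /xE ->.
Qed.

(** Both differentiability results below are instances of this one, since almost
    every point and every point of continuity is a Lebesgue point. *)
Lemma primitive_is_derive s t F f x : s < x < t -> primitive s t F f ->
  lebesgue_pt (f \_ `[s, t]) x -> is_derive x 1 F (f x).
Proof.
move=> /[dup] xst /andP[sx xt] acF fx.
have st := lt_trans sx xt.
have [C FE] := primitive_Rintegral st acF.
have fi : mu.-integrable setT (EFin \o (f \_ `[s, t])).
  rewrite -restrict_EFin; apply: (integrable_mkcond _ _).1 => //.
  exact: integrable_itv_oo_cc acF.1.
have fi' : mu.-integrable [set` Interval (BLeft s) (BRight t)]
    (EFin \o (f \_ `[s, t])).
  exact: integrableS fi.
have sx' : (BLeft s < BRight x)%E by rewrite (@lte_fin R).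
have [] := FTC1_lebesgue_pt xt fi' sx' fx.
rewrite /= patchE mem_set /=; last by rewrite in_itv /= !ltW.
set G := (X in derivable X) => dG GE.
have {}GE : is_derive x 1 G (f x).
  by apply: DeriveDef; [exact: dG|rewrite -derive1E; exact: GE].
have : is_derive x 1 (cst C + G) (f x).
  by apply: is_derive_eq; rewrite add0r.
apply: near_eq_is_derive; near=> y.
have sy : s < y by near: y; exact: lt_nbhsr.
have yt : y < t by near: y; exact: lt_nbhsl.
rewrite FE ?sy //; congr (_ + _); apply: eq_Rintegral => r.
rewrite inE /= in_itv /= => /andP[sr ry].
by rewrite patchE mem_set //= in_itv /= sr (le_trans ry) ?ltW.
Unshelve. all: by end_near. Qed.

Lemma primitive_ae_is_derive s t F f : primitive s t F f ->
  {ae mu, forall x, x \in `]s, t[ -> is_derive x 1 F (f x)}.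
Proof.
move=> acF.
have := lebesgue_differentiation
  (integrable_locally (measurable_itv `[s, t]) (integrable_itv_oo_cc acF.1)).
apply: ae_imply => x xP; rewrite in_itv /= => sxt.
exact: primitive_is_derive acF _.
Qed.

Lemma primitive_continuous_is_derive s t F f x : s < x < t -> primitive s t F f ->
  {for x, continuous f} -> is_derive x 1 F (f x).
Proof.
move=> /[dup] xst /andP[sx xt] acF cf; apply: (primitive_is_derive xst acF).
apply: (@continuous_lebesgue_pt _ _ _ `]s, t[) => //.
- apply/measurable_EFinP; rewrite -restrict_EFin.
  apply: (@measurable_funS _ _ _ _ setT) => //.
  apply/(measurable_restrictT _ _).1 => //.
  exact: (measurable_int mu (integrable_itv_oo_cc acF.1)).
- have E y : s < y < t -> (f \_ `[s, t]) y = f y.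
    by move=> /andP[sy yt]; rewrite patchE mem_set //= in_itv /= !ltW.
  apply: (cvg_trans _ (_ : f y @[y --> x] --> (f \_ `[s, t]) x)); last first.
    by rewrite E.
  apply: near_eq_cvg; near=> y; rewrite E //.
  apply/andP; split; near: y.
    exact: lt_nbhsr.
  exact: lt_nbhsl.
Unshelve. all: by end_near. Qed.

(** The hypothesis that f itself has a density makes f continuous and bounded, so
    that the fundamental theorem for continuous derivatives applies.  This is the
    situation of y and y' for y of class [W2]. *)
Lemma derivable_primitive s t F f g :
  (forall x, s < x < t -> derivable F x 1 /\ derive1 F x = f x) ->
  primitive s t f g -> primitive s t F f.
Proof.
move=> dF acf; split.
  case: (ltP s t) => [st|ts]; last first.
    by rewrite set_itv_ge ?bnd_simp -?leNgt //; exact: integrable_set0.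
  apply: measurable_bounded_integrable => //.
  - by rewrite /= lebesgue_measure_itv /= lte_fin st -EFinB ltry.
  - exact: primitive_measurable acf.
  - have [M bM] := primitive_bounded st acf.
    exists M; split; first exact: num_real.
    by move=> N /ltW MN x /=; rewrite in_itv /= => /bM/le_trans; apply.
move=> x1 x2 sx1; rewrite le_eqVlt => /predU1P[<- _|x12 x2t].
  by rewrite subrr set_itv1 Rintegral_set1.
have cF x : s < x < t -> {for x, continuous F}.
  by move=> /dF[? _]; apply: differentiable_continuous; apply/derivable1_diffP.
rewrite /Rintegral (@continuous_FTC2 _ f F) //.
- apply/continuous_within_itvP => //; split.
  + move=> x; rewrite in_itv /= => /andP[x1x xx2].
    by apply: (primitive_continuous acf); rewrite (lt_trans sx1) ?(lt_trans xx2).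
  + apply: cvg_at_right_filter; apply: (primitive_continuous acf).
    by rewrite sx1 (lt_trans x12).
  + apply: cvg_at_left_filter; apply: (primitive_continuous acf).
    by rewrite x2t (lt_trans sx1).
- split.
  + move=> x; rewrite in_itv /= => /andP[x1x xx2].
    by apply: (dF _ _).1; rewrite (lt_trans sx1) ?(lt_trans xx2).
  + apply: cvg_at_right_filter; apply: cF.
    by rewrite sx1 (lt_trans x12).
  + apply: cvg_at_left_filter; apply: cF.
    by rewrite x2t (lt_trans sx1).
- move=> x; rewrite in_itv /= => /andP[x1x xx2].
  by apply: (dF _ _).2; rewrite (lt_trans sx1) ?(lt_trans xx2).
Qed.

Lemma primitive_cst s t C : primitive s t (cst C) (cst 0).
Proof.
split; first exact: integrable0.
by move=> *; rewrite subrr Rintegral_cst // mul0r.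
Qed.

Lemma primitive_sub_integrable s t F f x1 x2 : primitive s t F f -> s < x1 -> x2 < t ->
  mu.-integrable `[x1, x2] (EFin \o f).
Proof.
move=> [fi _] sx1 x2t; apply: integrableS fi => //.
by apply: subset_itv; rewrite bnd_simp.
Qed.

Lemma primitiveD s t F f G g : primitive s t F f -> primitive s t G g ->
  primitive s t (fun x => F x + G x) (fun x => f x + g x).
Proof.
move=> acF acG; have [fi FE] := acF; have [gi GE] := acG; split.
  exact: integrableD fi gi.
move=> x1 x2 sx1 x12 x2t.
rewrite RintegralD ?(primitive_sub_integrable acF) ?(primitive_sub_integrable acG) //.
by rewrite -FE // -GE //; lra.
Qed.

Lemma primitiveN s t F f : primitive s t F f -> primitive s t (fun x => - F x) (fun x => - f x).
Proof.
move=> acF; have [fi FE] := acF; split.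
  exact: integrableN fi.
move=> x1 x2 sx1 x12 x2t.
under eq_Rintegral do rewrite -mulN1r.
rewrite RintegralZl ?(primitive_sub_integrable acF) //.
by rewrite -FE //; lra.
Qed.

(** By Tonelli the integral of the absolute value is at most the product of the
    integrals of |f| and |g|. *)
Lemma integrable_triangle f g :
  mu.-integrable setT (EFin \o f) -> mu.-integrable setT (EFin \o g) ->
  (mu \x mu)%E.-integrable setT
    (fun z => (f z.1 * (g z.2 * (z.1 < z.2)%R%:R))%:E).
Proof.
move=> fi gi.
have mf : measurable_fun setT f.
  by apply/measurable_EFinP; exact: (measurable_int mu fi).
have mg : measurable_fun setT g.
  by apply/measurable_EFinP; exact: (measurable_int mu gi).
pose H (z : R * R) : R := f z.1 * (g z.2 * (z.1 < z.2)%R%:R).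
have mH : measurable_fun setT H.
  apply: measurable_funM; first exact: measurableT_comp mf measurable_fst.
  apply: measurable_funM; first exact: measurableT_comp mg measurable_snd.
  apply: (@measurableT_comp _ _ _ _ _ _ (fun b : bool => b%:R : R)) => //.
  exact: measurable_fun_ltr.
have mHE : measurable_fun setT (abse \o (EFin \o H)).
  by apply: measurableT_comp => //; exact/measurable_EFinP.
apply/integrable12ltyP; first exact/measurable_EFinP.
have mag : measurable_fun setT (fun q => `|g q|) by exact: measurableT_comp.
have maf : measurable_fun setT (fun q => `|f q|) by exact: measurableT_comp.
pose b := \int[mu]_q `|g q|.
have BE : (\int[mu]_q `|g q|%:E = b%:E)%E.
  by rewrite fineK // integrable_fin_num //; exact: integrable_norm gi.
have b0 : 0 <= b by exact: Rintegral_ge0.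
apply: (@le_lt_trans _ _ (\int[mu]_r (`|f r| * b)%:E)%E); last first.
  under eq_integral do rewrite EFinM.
  rewrite ge0_integralZr //; last exact/measurable_EFinP.
  rewrite lte_mul_pinfty ?integral_ge0 //.
    exact: integrable_fin_num (integrable_norm fi).
  exact: ltry.
apply: ge0_le_integral => //.
- by move=> r _; apply: integral_ge0.
- apply: (measurable_fun_fubini_tonelli_F (m2 := mu) (abse \o (EFin \o H))) => [|z].
    exact: mHE.
  exact: abse_ge0.
- by apply/measurable_EFinP; exact: measurable_funM.
move=> r _; rewrite EFinM -BE -ge0_integralZl //; last exact/measurable_EFinP.
apply: ge0_le_integral => //.
- by have := measurableT_comp mHE (measurable_pair1 r).
- by apply: measurable_funeM; exact/measurable_EFinP.
- move=> q _; rewrite -EFinM lee_fin !normrM ler_wpM2l // ler_piMr //.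
  by rewrite normr_nat lern1 leq_b1.
Qed.

Lemma integrableM_bool f (p : R -> bool) :
  measurable_fun setT p -> mu.-integrable setT (EFin \o f) ->
  mu.-integrable setT (fun q => (f q * (p q)%:R)%:E).
Proof.
move=> mp fi; apply: (le_integrable _ _ _ fi) => //.
  apply/measurable_EFinP; apply: measurable_funM.
    by apply/measurable_EFinP; exact: (measurable_int mu fi).
  exact: (@measurableT_comp _ _ _ _ _ _ (fun b : bool => b%:R : R)).
move=> q _; rewrite /= lee_fin normrM ler_piMr //.
by rewrite normr_nat lern1 leq_b1.
Qed.

Lemma Fubini_triangle f g :
  mu.-integrable setT (EFin \o f) -> mu.-integrable setT (EFin \o g) ->
  \int[mu]_r (f r * \int[mu]_q (g q * (r < q)%R%:R)) =
  \int[mu]_q (g q * \int[mu]_r (f r * (r < q)%R%:R)).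
Proof.
move=> fi gi.
have H := Fubini (integrable_triangle fi gi).
have gE r : (\int[mu]_q (f r * (g q * (r < q)%R%:R))%:E =
    (f r * \int[mu]_q (g q * (r < q)%R%:R))%:E)%E.
  have gri : mu.-integrable setT (fun q => (g q * (r < q)%R%:R)%:E).
    by apply: integrableM_bool gi; exact: measurable_fun_ltr.
  rewrite EFinM fineK; last exact: integrable_fin_num gri.
  by rewrite -integralZl.
have fE q : (\int[mu]_r (f r * (g q * (r < q)%R%:R))%:E =
    (g q * \int[mu]_r (f r * (r < q)%R%:R))%:E)%E.
  have fqi : mu.-integrable setT (fun r => (f r * (r < q)%R%:R)%:E).
    by apply: integrableM_bool fi; exact: measurable_fun_ltr.
  rewrite EFinM fineK; last exact: integrable_fin_num fqi.
  by rewrite -integralZl //; apply: eq_integral => r _; rewrite -EFinM mulrCA.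
rewrite /Rintegral.
under eq_integral do rewrite -gE.
under [in RHS]eq_integral do rewrite -fE.
by congr fine.
Qed.

(** Integration by parts for merely integrable f and g: the integral of f(r) g(q)
    over the square is split along the diagonal, and on one of the two triangles
    the order of integration is exchanged. *)
Lemma Rintegral_mul_itv s t f g :
  mu.-integrable `[s, t] (EFin \o f) -> mu.-integrable `[s, t] (EFin \o g) ->
  (\int[mu]_(r in `[s, t]) f r) * (\int[mu]_(r in `[s, t]) g r) =
  \int[mu]_(r in `[s, t]) (f r * \int[mu]_(q in `[s, r]) g q) +
  \int[mu]_(r in `[s, t]) (g r * \int[mu]_(q in `[s, r]) f q).
Proof.
move=> fi gi.
have mkT h : mu.-integrable `[s, t] (EFin \o h) ->
    mu.-integrable setT (EFin \o (h \_ `[s, t])).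
  by move=> hi; rewrite -restrict_EFin; exact: (integrable_mkcond _ _).1.
have sub h r : r <= t -> mu.-integrable `[s, t] (EFin \o h) ->
    mu.-integrable `[s, r] (EFin \o h).
  by move=> rt; apply: integrableS => //; apply: subset_itvl; rewrite bnd_simp.
have gE r : s <= r -> r <= t ->
   \int[mu]_q ((g \_ `[s, t]) q * (r < q)%R%:R) =
   \int[mu]_(q in `[s, t]) g q - \int[mu]_(q in `[s, r]) g q.
  move=> sr rt; rewrite (@Rintegral_itvB _ g (BLeft s) (BRight t)) ?bnd_simp //.
  rewrite [RHS]Rintegral_mkcond; apply: eq_Rintegral => q _.
  rewrite !patchE !mem_setE !in_itv /=; case: (ltP r q) => rq /=; last first.
    by rewrite mulr0.
  by rewrite (le_trans sr (ltW rq)) mulr1.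
have fE q : s <= q -> q <= t ->
   \int[mu]_r ((f \_ `[s, t]) r * (r < q)%R%:R) = \int[mu]_(r in `[s, q]) f r.
  move=> sq qt; rewrite -Rintegral_itv_bndo_bndc; last first.
    by apply: integrableS (sub _ _ qt fi) => //; apply: subset_itvl; rewrite bnd_simp.
  rewrite [RHS]Rintegral_mkcond; apply: eq_Rintegral => r _.
  rewrite !patchE !mem_setE !in_itv /=; case: (ltP r q) => rq /=; last first.
    by rewrite mulr0 andbF.
  by rewrite (le_trans (ltW rq) qt) !andbT mulr1.
have H : \int[mu]_(r in `[s, t])
      (f r * (\int[mu]_(q in `[s, t]) g q - \int[mu]_(q in `[s, r]) g q)) =
    \int[mu]_(r in `[s, t]) (g r * \int[mu]_(q in `[s, r]) f q).
  rewrite Rintegral_mkcond [RHS]Rintegral_mkcond.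
  transitivity (\int[mu]_r ((f \_ `[s, t]) r *
    \int[mu]_q ((g \_ `[s, t]) q * (r < q)%R%:R))).
    apply: eq_Rintegral => r _; rewrite 2!patchE mem_setE in_itv /=.
    by case: andP => [[sr rt]|]; rewrite ?mul0r // gE.
  rewrite (Fubini_triangle (mkT _ fi) (mkT _ gi)).
  apply: eq_Rintegral => r _; rewrite 2!patchE mem_setE in_itv /=.
  by case: andP => [[sr rt]|]; rewrite ?mul0r // fE.
have fGi : mu.-integrable `[s, t]
    (EFin \o (fun r => f r * \int[mu]_(q in `[s, r]) g q)).
  case: (leP s t) => [st|ts]; last first.
    by rewrite set_itv_ge ?bnd_simp -?ltNge //; exact: integrable_set0.
  have cG := parameterized_integral_continuous st gi.
  have mG : measurable_fun `[s, t] (fun r => \int[mu]_(q in `[s, r]) g q).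
    exact: subspace_continuous_measurable_fun.
  apply: (integrableMl _ fi mG) => //.
  have [M [Mr bM]] :=
    compact_bounded (continuous_compact cG (@segment_compact _ s t)).
  exists M; split => // N MN x xst; apply: (bM N) => //.
  by exists x.
rewrite -H -RintegralZr // -RintegralD //; last first.
  apply: eq_integrable (integrableB _ (integrableZr _ _ fi) fGi) => //.
    by move=> r _; rewrite /= -EFinM -EFinB -mulrBr.
by apply: eq_Rintegral => r _; lra.
Qed.

Lemma primitive_integrableM s t F f g : primitive s t F f ->
  mu.-integrable `]s, t[ (EFin \o g) ->
  mu.-integrable `]s, t[ (EFin \o (fun x => g x * F x)).
Proof.
move=> acF gi; case: (ltP s t) => [st|ts]; last first.
  by rewrite set_itv_ge ?bnd_simp -?leNgt //; exact: integrable_set0.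
apply: (integrableMl _ gi (primitive_measurable acF)) => //.
have [M bM] := primitive_bounded st acF.
exists M; split; first exact: num_real.
by move=> N /ltW MN x /=; rewrite in_itv /= => /bM/le_trans; apply.
Qed.

(** On [[x1, x2]] write F = F(x1) + Phi and G = G(x1) + Gamma with Phi, Gamma the
    integrals of the densities from x1; the bilinear remainder
    Phi(x2) Gamma(x2) is evaluated by [Rintegral_mul_itv]. *)
Lemma primitiveM s t F f G g : primitive s t F f -> primitive s t G g ->
  primitive s t (fun x => F x * G x) (fun x => f x * G x + g x * F x).
Proof.
move=> acF acG; have [fi FE] := acF; have [gi GE] := acG.
have fGi := primitive_integrableM acG fi; have gFi := primitive_integrableM acF gi.
split; first exact: integrableD fGi gFi.
move=> x1 x2 sx1 x12 x2t.
have fi' := primitive_sub_integrable acF sx1 x2t.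
have gi' := primitive_sub_integrable acG sx1 x2t.
have sub h : mu.-integrable `]s, t[ (EFin \o h) ->
    mu.-integrable `[x1, x2] (EFin \o h).
  by apply: integrableS => //; apply: subset_itv; rewrite bnd_simp.
have := Rintegral_mul_itv fi' gi'.
have -> : \int[mu]_(r in `[x1, x2]) (f r * \int[mu]_(q in `[x1, r]) g q) =
  \int[mu]_(r in `[x1, x2]) (f r * G r) -
  (\int[mu]_(r in `[x1, x2]) f r) * G x1.
  rewrite -RintegralZr // -RintegralB //; [|exact: sub|exact: (integrableZr _ _ fi')].
  apply: eq_Rintegral => r; rewrite inE /= in_itv /= => /andP[x1r rx2].
  by rewrite -GE ?(le_lt_trans rx2) //; lra.
have -> : \int[mu]_(r in `[x1, x2]) (g r * \int[mu]_(q in `[x1, r]) f q) =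
  \int[mu]_(r in `[x1, x2]) (g r * F r) -
  (\int[mu]_(r in `[x1, x2]) g r) * F x1.
  rewrite -RintegralZr // -RintegralB //; [|exact: sub|exact: (integrableZr _ _ gi')].
  apply: eq_Rintegral => r; rewrite inE /= in_itv /= => /andP[x1r rx2].
  by rewrite -FE ?(le_lt_trans rx2) //; lra.
rewrite RintegralD //; [|exact: sub|exact: sub].
by rewrite -FE // -GE //; lra.
Qed.
End RealPrimitives.

(** * Complex-valued primitives, one-sided limits and the class W2 *)

Local Open Scope complex_scope.

Section ComplexPrimitives.
Context {R : realType}.
Implicit Types (s t x : R) (F G f g y z w : R -> R[i]).
Notation mu := (@lebesgue_measure R).

Lemma reFD f g : reF (fun x => f x + g x) = (fun x => reF f x + reF g x).
Proof. by apply/funext => x; rewrite /reF; case: (f x) (g x) => [a b] []. Qed.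

Lemma imFD f g : imF (fun x => f x + g x) = (fun x => imF f x + imF g x).
Proof. by apply/funext => x; rewrite /imF; case: (f x) (g x) => [a b] []. Qed.

Lemma reFN f : reF (fun x => - f x) = (fun x => - reF f x).
Proof. by apply/funext => x; rewrite /reF; case: (f x). Qed.

Lemma imFN f : imF (fun x => - f x) = (fun x => - imF f x).
Proof. by apply/funext => x; rewrite /imF; case: (f x). Qed.

Lemma reFM f g :
  reF (fun x => f x * g x) = (fun x => reF f x * reF g x + - (imF f x * imF g x)).
Proof. by apply/funext => x; rewrite /reF /imF; case: (f x) (g x) => [a b] []. Qed.

Lemma imFM f g :
  imF (fun x => f x * g x) = (fun x => reF f x * imF g x + imF f x * reF g x).
Proof. by apply/funext => x; rewrite /reF /imF; case: (f x) (g x) => [a b] []. Qed.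

Definition primitiveC s t F f := primitive s t (reF F) (reF f) /\ primitive s t (imF F) (imF f).

Lemma abs_contP s t F : abs_cont s t F <-> exists f, primitiveC s t F f.
Proof.
split=> [[f [rf jf] FE]|[f [[rf rE] [jf jE]]]]; exists f => //.
- split; split => // x1 x2 sx1 x12 x2t; have := FE x1 x2 sx1 x12 x2t.
  + by rewrite /reF /=; case: (F x2) (F x1) => [a b] [c d] [].
  + by rewrite /imF /=; case: (F x2) (F x1) => [a b] [c d] [].
- move=> x1 x2 sx1 x12 x2t; rewrite /intC -rE // -jE // /reF /imF.
  by case: (F x2) (F x1) => [a b] [c d].
Qed.

Lemma primitive_eq_density s t (F f g : R -> R) : (forall x, s < x < t -> f x = g x) ->
  primitive s t F f -> primitive s t F g.
Proof.
move=> fg acF; apply: (primitive_eq_ae _ _ acF).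
  apply: (@eq_measurable_fun _ _ _ _ _ f).
    by move=> x; rewrite inE /= in_itv /= => /fg.
  by apply/measurable_EFinP; exact: (measurable_int mu acF.1).
by apply: aeW => x; rewrite in_itv /= => /fg.
Qed.

Lemma primitiveC_eq s t F G f g :
  (forall x, s < x < t -> F x = G x) -> (forall x, s < x < t -> f x = g x) ->
  primitiveC s t F f -> primitiveC s t G g.
Proof.
move=> FG fg [rF jF]; split.
- apply: (@primitive_eq_density _ _ _ (reF f)) => [x /fg fgx|]; first by rewrite /reF fgx.
  by apply: primitive_eq_fun rF => x /FG FGx; rewrite /reF FGx.
- apply: (@primitive_eq_density _ _ _ (imF f)) => [x /fg fgx|]; first by rewrite /imF fgx.
  by apply: primitive_eq_fun jF => x /FG FGx; rewrite /imF FGx.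
Qed.

Lemma primitiveC_cst s t (C : R[i]) : primitiveC s t (fun=> C) (fun=> 0).
Proof. by split; exact: primitive_cst. Qed.

Lemma primitiveCD s t F f G g : primitiveC s t F f -> primitiveC s t G g ->
  primitiveC s t (fun x => F x + G x) (fun x => f x + g x).
Proof.
move=> [rF jF] [rG jG].
by split; rewrite ?reFD ?imFD; exact: primitiveD.
Qed.

Lemma primitiveCN s t F f : primitiveC s t F f -> primitiveC s t (fun x => - F x) (fun x => - f x).
Proof. by move=> [rF jF]; split; rewrite ?reFN ?imFN; exact: primitiveN. Qed.

Lemma primitiveCM s t F f G g : primitiveC s t F f -> primitiveC s t G g ->
  primitiveC s t (fun x => F x * G x) (fun x => f x * G x + F x * g x).
Proof.
move=> [rF jF] [rG jG]; split.
- rewrite reFM; apply: primitive_eq_density (primitiveD (primitiveM rF rG) (primitiveN (primitiveM jF jG))) => x _.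
  by rewrite reFD !reFM; ring.
- rewrite imFM; apply: primitive_eq_density (primitiveD (primitiveM rF jG) (primitiveM jF rG)) => x _.
  by rewrite imFD !imFM; ring.
Qed.

(** Componentwise convergence, so that [limp] and [limm] are the cases of the
    filters of right and left neighbourhoods. *)
Definition cvgC (A : set_system R) F (l : R[i]) : Prop :=
  reF F x @[x --> A] --> complex.Re l /\ imF F x @[x --> A] --> complex.Im l.

Section cvgC.
Context (A : set_system R) {FA : ProperFilter A}.

Lemma cvgC_cst (C : R[i]) : cvgC A (fun=> C) C.
Proof. by split; exact: cvg_cst. Qed.

Lemma cvgCD F G k l : cvgC A F k -> cvgC A G l ->
  cvgC A (fun x => F x + G x) (k + l).
Proof.
move=> [rF jF] [rG jG]; split.
- rewrite reFD (_ : complex.Re _ = complex.Re k + complex.Re l); first exact: cvgD.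
  by case: k l {rF jF rG jG} => [? ?] [].
- rewrite imFD (_ : complex.Im _ = complex.Im k + complex.Im l); first exact: cvgD.
  by case: k l {rF jF rG jG} => [? ?] [].
Qed.

Lemma cvgCN F k : cvgC A F k -> cvgC A (fun x => - F x) (- k).
Proof.
move=> [rF jF]; split.
- rewrite reFN (_ : complex.Re _ = - complex.Re k); first exact: cvgN.
  by case: k {rF jF}.
- rewrite imFN (_ : complex.Im _ = - complex.Im k); first exact: cvgN.
  by case: k {rF jF}.
Qed.

Lemma cvgCM F G k l : cvgC A F k -> cvgC A G l ->
  cvgC A (fun x => F x * G x) (k * l).
Proof.
move=> [rF jF] [rG jG]; split.
- rewrite reFM (_ : complex.Re _ =
    complex.Re k * complex.Re l + - (complex.Im k * complex.Im l)).
    by apply: cvgD; [exact: cvgM|apply: cvgN; exact: cvgM].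
  by case: k l {rF jF rG jG} => [? ?] [].
- rewrite imFM (_ : complex.Im _ =
    complex.Re k * complex.Im l + complex.Im k * complex.Re l).
    by apply: cvgD; exact: cvgM.
  by case: k l {rF jF rG jG} => [? ?] [].
Qed.

Lemma cvgC_near F G k : (\forall x \near A, F x = G x) -> cvgC A F k -> cvgC A G k.
Proof.
move=> FG [rF jF]; split.
- apply: (cvg_trans _ rF); apply: near_eq_cvg.
  by apply: filterS FG => x; rewrite /reF => ->.
- apply: (cvg_trans _ jF); apply: near_eq_cvg.
  by apply: filterS FG => x; rewrite /imF => ->.
Qed.

Lemma cvgC_unique F k l : cvgC A F k -> cvgC A F l -> k = l.
Proof.
case: k l => [a b] [c d] [/= ra ib] [/= rc jd].
congr (_ +i* _).
- exact: (cvg_unique (@Rhausdorff R) ra rc).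
- exact: (cvg_unique (@Rhausdorff R) ib jd).
Qed.

End cvgC.

Lemma limpE F x l : cvgC x^'+ F l -> limp F x = l.
Proof.
case: l => a b [/= ra jb]; rewrite /limp.
by congr (_ +i* _); apply: cvg_lim => //; exact: Rhausdorff.
Qed.

Lemma limmE F x l : cvgC x^'- F l -> limm F x = l.
Proof.
case: l => a b [/= ra jb]; rewrite /limm.
by congr (_ +i* _); apply: cvg_lim => //; exact: Rhausdorff.
Qed.

Lemma primitiveC_limp s t F f : s < t -> primitiveC s t F f -> cvgC s^'+ F (limp F s).
Proof.
move=> st [rF jF].
have [a ra] := primitive_cvg_right st rF; have [b jb] := primitive_cvg_right st jF.
have H : cvgC s^'+ F (a +i* b) by [].
by rewrite (limpE H).
Qed.

Lemma primitiveC_limm s t F f : s < t -> primitiveC s t F f -> cvgC t^'- F (limm F t).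
Proof.
move=> st [rF jF].
have [a ra] := primitive_cvg_left st rF; have [b jb] := primitive_cvg_left st jF.
have H : cvgC t^'- F (a +i* b) by [].
by rewrite (limmE H).
Qed.

Lemma cvgC_eq_right s t F G k : s < t -> (forall x, s < x < t -> F x = G x) ->
  cvgC s^'+ F k -> cvgC s^'+ G k.
Proof.
move=> st FG; apply: cvgC_near; near=> x; apply: FG; apply/andP; split; near: x.
  exact: nbhs_right_gt.
exact: nbhs_right_lt.
Unshelve. all: by end_near. Qed.

Lemma cvgC_eq_left s t F G k : s < t -> (forall x, s < x < t -> F x = G x) ->
  cvgC t^'- F k -> cvgC t^'- G k.
Proof.
move=> st FG; apply: cvgC_near; near=> x; apply: FG; apply/andP; split; near: x.
  exact: nbhs_left_gt.
exact: nbhs_left_lt.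
Unshelve. all: by end_near. Qed.

Lemma limp_eq s t F f G : s < t -> primitiveC s t F f ->
  (forall x, s < x < t -> F x = G x) -> limp G s = limp F s.
Proof.
move=> st acF FG; apply: limpE.
exact: (cvgC_eq_right st FG (primitiveC_limp st acF)).
Qed.

Lemma limm_eq s t F f G : s < t -> primitiveC s t F f ->
  (forall x, s < x < t -> F x = G x) -> limm G t = limm F t.
Proof.
move=> st acF FG; apply: limmE.
exact: (cvgC_eq_left st FG (primitiveC_limm st acF)).
Qed.

(** The density f is continuous because it has a density of its own. *)
Lemma primitiveC_cderiv s t F f g x : s < x < t -> primitiveC s t F f -> primitiveC s t f g ->
  [/\ derivable (reF F) x 1, derivable (imF F) x 1 & cderiv F x = f x].
Proof.
move=> xst [rF jF] [rf jf].
have [dr rE] := primitive_continuous_is_derive xst rF (primitive_continuous rf xst).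
have [dj jE] := primitive_continuous_is_derive xst jF (primitive_continuous jf xst).
split; [exact: dr|exact: dj|]; rewrite /cderiv !derive1E rE jE /reF /imF.
by case: (f x).
Qed.

Lemma primitiveC_ae_cderiv s t F f : primitiveC s t F f -> eqae `]s, t[ (cderiv F) f.
Proof.
move=> [/primitive_ae_is_derive rF /primitive_ae_is_derive jF].
apply: ae_imply2 rF jF => x rx jx xst; rewrite /cderiv !derive1E.
have [_ ->] := rx xst; have [_ ->] := jx xst.
by rewrite /reF /imF; case: (f x).
Qed.

(** The triple y, y', y'' of a function of class [W2]; y'' matters only up to
    null sets, which is why it is carried as a density w. *)
Definition jet2 s t y z w := primitiveC s t y z /\ primitiveC s t z w.

Lemma W2_jet s t y : W2 s t y -> exists w, jet2 s t y (cderiv y) w.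
Proof.
move=> [dy /abs_contP[w yw]]; exists w; split => //.
by split; [apply: (derivable_primitive _ yw.1)|apply: (derivable_primitive _ yw.2)];
  move=> x /dy[].
Qed.

Lemma jet_cderiv s t y z w : jet2 s t y z w ->
  forall x, s < x < t -> cderiv y x = z x.
Proof. by move=> [yz zw] x xst; have [] := primitiveC_cderiv xst yz zw. Qed.

Lemma jet_W2 s t y z w : jet2 s t y z w -> W2 s t y.
Proof.
move=> J; have [yz zw] := J; split.
  by move=> x xst; have [] := primitiveC_cderiv xst yz zw.
apply/abs_contP; exists w; apply: primitiveC_eq zw => // x xst.
by rewrite (jet_cderiv J).
Qed.

(** The pointwise derivative of y' in [ell] is the density w almost everywhere,
    by Lebesgue differentiation. *)
Lemma jet_ell q s t y z w : jet2 s t y z w ->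
  eqae `]s, t[ (ell q y) (fun x => - w x + q x * y x).
Proof.
move=> J; have [yz zw] := J.
have /primitiveC_ae_cderiv : primitiveC s t (cderiv y) w.
  by apply: primitiveC_eq zw => // x xst; rewrite (jet_cderiv J).
by apply: ae_imply => x xE xst; rewrite /ell xE.
Qed.

End ComplexPrimitives.

(** * Square-integrable functions and complex integrals *)

Section L2.
Context {R : realType}.
Implicit Types (s t x : R) (D : set R).
Notation mu := (@lebesgue_measure R).

(** Reduces square integrability to integrability of the square, for which
    domination and restriction arguments are available. *)
Lemma Lfun2P (f : R -> R) : f \in Lfun mu 2%:E <->
  measurable_fun setT f /\ mu.-integrable setT (EFin \o (fun x => f x ^+ 2)).
Proof.
split=> [fL|[mf fi]].
  split; last exact: Lfun2_integrable_sqr.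
  by have := sub_Lfun_mfun fL; rewrite inE.
apply/andP; split; rewrite inE //= /finite_norm unlock /Lnorm.
apply: poweR_lty; move/integrableP : fi => [_].
congr (_ < _)%E; apply: eq_integral => x _ /=.
by rewrite powR_mulrn // normrX.
Qed.

Lemma Lfun2_le (f g : R -> R) : measurable_fun setT g ->
  (forall x, `|g x| <= `|f x|) -> f \in Lfun mu 2%:E -> g \in Lfun mu 2%:E.
Proof.
move=> mg gf /Lfun2P[mf fi]; apply/Lfun2P; split => //.
apply: (le_integrable _ _ _ fi) => //.
  by apply/measurable_EFinP; exact: measurable_funX.
by move=> x _ /=; rewrite lee_fin !normrX lerXn2r ?nnegrE.
Qed.

(** The real and imaginary parts of [L2]. *)
Definition l2 D (f : R -> R) := f \_ D \in Lfun mu 2%:E.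

Lemma l2_eq D (f g : R -> R) : (forall x, D x -> f x = g x) -> l2 D f -> l2 D g.
Proof.
move=> fg; rewrite /l2; suff -> : f \_ D = g \_ D by [].
by apply/eq_restrictP => x; rewrite inE; exact: fg.
Qed.

Lemma l2D D (f g : R -> R) : l2 D f -> l2 D g -> l2 D (fun x => f x + g x).
Proof.
move=> lf lg; have := (Lfun_addr_closed mu (lee1n 2)).2 _ _ lf lg.
rewrite /l2; suff -> : (fun x => f x + g x) \_ D = f \_ D + g \_ D by [].
apply/funext => x; rewrite /GRing.add /= !patchE.
by case: ifP => _; rewrite ?addr0.
Qed.

Lemma l2Z D c (f : R -> R) : l2 D f -> l2 D (fun x => c * f x).
Proof.
move=> lf; have := Lfun_scale c (ler1n _ 2) lf.
rewrite /l2; suff -> : (fun x => c * f x) \_ D = c \o* (f \_ D) by [].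
apply/funext => x; rewrite /= !patchE.
by case: ifP => _; rewrite ?mul0r // mulrC.
Qed.

Lemma l2S D D' (f : R -> R) : measurable D -> measurable D' -> D' `<=` D -> l2 D f -> l2 D' f.
Proof.
move=> mD mD' sub lf; apply: Lfun2_le (lf) => [|x]; last first.
  rewrite !patchE; case: ifPn => [/set_mem xD'|_]; last by rewrite normr0.
  by rewrite mem_set //; exact: sub.
have -> : f \_ D' = (f \_ D) \_ D'.
  apply/funext => x; rewrite !patchE; case: ifPn => // /set_mem xD'.
  by rewrite mem_set //; exact: sub.
apply/(measurable_restrictT _ _).1 => //.
have /Lfun2P[mf _] := lf.
exact: measurable_funS mf.
Qed.

Lemma l2U D D' (f : R -> R) : D `&` D' = set0 ->
  l2 D f -> l2 D' f -> l2 (D `|` D') f.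
Proof.
move=> DD' lf lf'; have := (Lfun_addr_closed mu (lee1n 2)).2 _ _ lf lf'.
rewrite /l2; suff -> : f \_ (D `|` D') = f \_ D + f \_ D' by [].
apply/funext => x; rewrite /GRing.add /= !patchE in_setU.
case: (boolP (x \in D)) (boolP (x \in D')) => [xD [xD'|_]|_ [_|_]] /=; rewrite ?addr0 ?add0r //.
by have : set0 x by rewrite -DD'; split; exact: set_mem.
Qed.

Lemma l2_bounded D M (f : R -> R) : measurable D -> (mu D < +oo)%E ->
  measurable_fun D f -> (forall x, D x -> `|f x| <= M) -> l2 D f.
Proof.
move=> mD fD mf bf; apply/Lfun2P; split.
  by apply/(measurable_restrictT _ _).1.
have -> : (fun x => (f \_ D) x ^+ 2) = (fun x => f x ^+ 2) \_ D.
  by apply/funext => x; rewrite !patchE; case: ifP => //; rewrite expr0n.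
rewrite -restrict_EFin; apply: (integrable_mkcond _ _).1 => //.
apply: measurable_bounded_integrable => //; first exact: measurable_funX.
exists (M ^+ 2); split; first exact: num_real.
move=> N /ltW MN x /= Dx; apply: le_trans MN.
have Mx := bf _ Dx.
by rewrite normrX lerXn2r ?nnegrE // (le_trans _ Mx).
Qed.

Lemma l2_set1 c (f : R -> R) : l2 [set c] f.
Proof.
apply: (@l2_bounded _ `|f c|) => //.
- by rewrite /= lebesgue_measure_set1 ltry.
- exact: measurable_fun_set1.
- by move=> x ->.
Qed.

Lemma itv_oo_fin s t : (mu `]s, t[ < +oo)%E.
Proof.
by rewrite /= lebesgue_measure_itv /= lte_fin; case: ifP => _; rewrite -?EFinB ltry.
Qed.

Lemma l2_integrable s t (f : R -> R) : l2 `]s, t[ f ->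
  mu.-integrable `]s, t[ (EFin \o f).
Proof.
move=> lf; have l1 : l2 `]s, t[ (cst 1).
  apply: (@l2_bounded _ 1) => //; first exact: itv_oo_fin.
  by move=> x _; rewrite normr1.
have /Lfun1_integrable := Lfun2_mul_Lfun1 lf l1.
move=> fi; apply: (integrable_mkcond _ _).2 => //.
rewrite restrict_EFin; apply: eq_integrable fi => // x _ /=.
by rewrite !patchE; case: ifP => _; rewrite ?mulr1 ?mul0r.
Qed.

Lemma primitive_l2 s t (F f : R -> R) : primitive s t F f -> l2 `]s, t[ F.
Proof.
move=> acF; case: (ltP s t) => [st|ts].
  have [M bM] := primitive_bounded st acF.
  apply: (@l2_bounded _ M) => //; first exact: itv_oo_fin.
    exact: primitive_measurable acF.
rewrite set_itv_ge ?bnd_simp -?leNgt //.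
by apply: (@l2_bounded _ 0) => //; rewrite ?measure0 //; exact: measurable_fun_set0.
Qed.

End L2.

Section complexL2.
Context {R : realType}.
Implicit Types (s t x m : R) (D : set R) (F G f g h : R -> R[i]).
Notation mu := (@lebesgue_measure R).

Lemma L2_eq D f g : (forall x, D x -> f x = g x) -> L2 D f -> L2 D g.
Proof.
move=> fg [rf jf]; split.
- by apply: l2_eq rf => x /fg fgx; rewrite /reF fgx.
- by apply: l2_eq jf => x /fg fgx; rewrite /imF fgx.
Qed.

Lemma L2D D f g : L2 D f -> L2 D g -> L2 D (fun x => f x + g x).
Proof.
by move=> [rf jf] [rg jg]; split; rewrite ?reFD ?imFD; exact: l2D.
Qed.

Lemma L2Z D (c : R[i]) f : L2 D f -> L2 D (fun x => c * f x).
Proof.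
move=> [rf jf]; split; rewrite ?reFM ?imFM.
- apply: l2D; first exact: l2Z.
  have := l2Z (-1) (l2Z (complex.Im c) jf).
  by apply: l2_eq => x _; rewrite mulN1r.
- by apply: l2D; exact: l2Z.
Qed.

Lemma L2N D f : L2 D f -> L2 D (fun x => - f x).
Proof.
by move=> /(L2Z (-1)); apply: L2_eq => x _; rewrite mulN1r.
Qed.

Lemma L2S D D' f : measurable D -> measurable D' -> D' `<=` D -> L2 D f -> L2 D' f.
Proof. by move=> mD mD' sub [rf jf]; split; exact: l2S sub _. Qed.

(** The point m is Borel and null, so the value f(m) is irrelevant. *)
Lemma L2_glue s m t f : s < m -> m < t ->
  L2 `]s, m[ f -> L2 `]m, t[ f -> L2 `]s, t[ f.
Proof.
move=> sm mt [rf jf] [rg jg].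
have E : `]s, t[%classic = `]s, m[ `|` ([set m] `|` `]m, t[).
  apply/seteqP; split=> x /=; rewrite !in_itv /=.
    move=> /andP[sx xt]; case: (ltgtP x m) => xm.
    - by left; rewrite sx.
    - by right; right.
    - by right; left.
  case=> [/andP[sx xm]|[->|/andP[mx xt]]].
  - by rewrite sx (lt_trans xm).
  - by rewrite sm.
  - by rewrite xt (lt_trans sm).
have d1 : [set m] `&` `]m, t[ = set0.
  by apply/seteqP; split => x //= [->]; rewrite in_itv /= ltxx.
have d2 : `]s, m[ `&` ([set m] `|` `]m, t[) = set0.
  apply/seteqP; split => x //=; rewrite !in_itv /= => -[/andP[_ xm]] [xE|].
    by rewrite xE ltxx in xm.
  by move=> /andP[/(lt_trans xm)]; rewrite ltxx.
by split; rewrite /= E; apply: (l2U d2) => //; apply: (l2U d1) => //; exact: l2_set1.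
Qed.

Lemma L2_integrable s t f : L2 `]s, t[ f -> integrableC `]s, t[ f.
Proof. by move=> [rf jf]; split; exact: l2_integrable. Qed.

Lemma primitiveC_L2 s t F f : primitiveC s t F f -> L2 `]s, t[ F.
Proof. by move=> [rF jF]; split; [exact: primitive_l2 rF|exact: primitive_l2 jF]. Qed.

Lemma integrableC_eq D f g : measurable D -> (forall x, D x -> f x = g x) ->
  integrableC D f -> integrableC D g.
Proof.
move=> mD fg [rf jf]; split.
- by apply: eq_integrable rf => // x /set_mem /fg /= E; rewrite /reF E.
- by apply: eq_integrable jf => // x /set_mem /fg /= E; rewrite /imF E.
Qed.

Lemma intC_eq D f g : (forall x, D x -> f x = g x) -> intC D f = intC D g.
Proof.
move=> fg; congr (_ +i* _).
- by apply: eq_Rintegral => x /set_mem /fg E; rewrite /reF E.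
- by apply: eq_Rintegral => x /set_mem /fg E; rewrite /imF E.
Qed.

Lemma intC_eq0 D f : (forall x, D x -> f x = 0) -> intC D f = 0.
Proof.
move=> f0; have -> : intC D f = intC D (fun=> 0) by exact: intC_eq.
rewrite /intC; congr (_ +i* _).
- by rewrite /Rintegral integral0.
- by rewrite /Rintegral integral0.
Qed.

Lemma integrableCS D D' f : measurable D -> measurable D' -> D' `<=` D ->
  integrableC D f -> integrableC D' f.
Proof.
move=> mD mD' sub [rf jf].
by split; [apply: integrableS rf|apply: integrableS jf].
Qed.

Lemma integrable_ZlR D c (f : R -> R) : measurable D ->
  mu.-integrable D (EFin \o f) -> mu.-integrable D (EFin \o (fun x => c * f x)).
Proof. by move=> mD fi; apply: integrableZl fi. Qed.

Lemma integrable_DR D (f g : R -> R) : measurable D ->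
  mu.-integrable D (EFin \o f) -> mu.-integrable D (EFin \o g) ->
  mu.-integrable D (EFin \o (fun x => f x + g x)).
Proof. by move=> mD fi gi; apply: integrableD fi gi. Qed.

Lemma integrable_NR D (f : R -> R) : measurable D ->
  mu.-integrable D (EFin \o f) -> mu.-integrable D (EFin \o (fun x => - f x)).
Proof. by move=> mD fi; apply: integrableN fi. Qed.

Lemma integrableCZ D (c : R[i]) f : measurable D -> integrableC D f ->
  integrableC D (fun x => c * f x).
Proof.
move=> mD [rf jf]; split; rewrite ?reFM ?imFM.
- apply: integrable_DR; [by []|exact: integrable_ZlR|].
  by apply: integrable_NR; [by []|exact: integrable_ZlR].
- by apply: integrable_DR; [by []|exact: integrable_ZlR|exact: integrable_ZlR].
Qed.

Lemma intCZ D (c : R[i]) f : measurable D -> integrableC D f ->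
  intC D (fun x => c * f x) = c * intC D f.
Proof.
move=> mD [rf jf]; rewrite /intC reFM imFM.
rewrite RintegralB ?RintegralD //; try exact: integrable_ZlR.
by rewrite !RintegralZl //; case: c.
Qed.

Lemma integrableCM_primitiveC s t F f h : primitiveC s t F f -> integrableC `]s, t[ h ->
  integrableC `]s, t[ (fun x => h x * F x).
Proof.
move=> [rF jF] [rh jh]; split; rewrite ?reFM ?imFM.
- apply: integrable_DR; [by []|exact: primitive_integrableM rF rh|].
  by apply: integrable_NR; [by []|exact: primitive_integrableM jF jh].
- apply: integrable_DR; [by []|exact: primitive_integrableM jF rh|].
  exact: primitive_integrableM rF jh.
Qed.

Lemma integrable_glue s m t (f : R -> R) : s < m -> m < t ->
  mu.-integrable `]s, m[ (EFin \o f) -> mu.-integrable `]m, t[ (EFin \o f) ->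
  mu.-integrable `]s, t[ (EFin \o f).
Proof.
move=> sm mt fi gi; apply/integrable_mkcond => //.
have fi' : mu.-integrable `]s, m] (EFin \o f).
  by apply: integrableS (integrable_itv_oo_cc fi) => //; apply: subset_itvr;
    rewrite bnd_simp.
have fT : mu.-integrable setT (EFin \o (f \_ `]s, m])).
  by rewrite -restrict_EFin; apply: (integrable_mkcond _ _).1.
have gT : mu.-integrable setT (EFin \o (f \_ `]m, t[)).
  by rewrite -restrict_EFin; apply: (integrable_mkcond _ _).1.
rewrite restrict_EFin.
apply: eq_integrable (integrable_DR measurableT fT gT) => // x _ /=.
congr EFin; rewrite !patchE !mem_setE !in_itv /=.
case: (ltP m x) => [mx|xm].
  by rewrite (lt_trans sm mx) andbF /=; case: ifP => _; rewrite add0r.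
by rewrite /= (le_lt_trans xm mt) andbT addr0.
Qed.

Lemma Rintegral_glue s m t (f : R -> R) : s < m -> m < t ->
  mu.-integrable `]s, m[ (EFin \o f) -> mu.-integrable `]m, t[ (EFin \o f) ->
  \int[mu]_(x in `]s, t[) f x =
  \int[mu]_(x in `]s, m[) f x + \int[mu]_(x in `]m, t[) f x.
Proof.
move=> sm mt fi gi; have hi := integrable_glue sm mt fi gi.
rewrite (Rintegral_itv_bndo_bndc fi).
by rewrite -(@Rintegral_itvB _ f (BRight s) (BLeft t) m) ?bnd_simp ?ltW // addrC subrK.
Qed.

Lemma intC_glue s m t f : s < m -> m < t ->
  integrableC `]s, m[ f -> integrableC `]m, t[ f ->
  intC `]s, t[ f = intC `]s, m[ f + intC `]m, t[ f.
Proof.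
by move=> sm mt [rf jf] [rg jg]; rewrite /intC !(@Rintegral_glue s m t).
Qed.

Lemma integrableC_glue s m t f : s < m -> m < t ->
  integrableC `]s, m[ f -> integrableC `]m, t[ f -> integrableC `]s, t[ f.
Proof.
move=> sm mt [rf jf] [rg jg].
by split; [exact: integrable_glue rf rg|exact: integrable_glue jf jg].
Qed.

Lemma Rintegral_oo_cc s t x (f : R -> R) : mu.-integrable `]s, t[ (EFin \o f) ->
  s < x < t -> \int[mu]_(r in `]s, x[) f r = \int[mu]_(r in `[s, x]) f r.
Proof.
move=> fi /andP[sx xt].
have fi' : mu.-integrable `]s, x[ (EFin \o f).
  by apply: integrableS fi => //; apply: subset_itvl; rewrite bnd_simp ltW.
rewrite Rintegral_itv_bndo_bndc //.
rewrite Rintegral_itv_obnd_cbnd //.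
by apply: integrableS fi => //; apply: subset_itvl; rewrite bnd_simp.
Qed.

Lemma primitiveC_intC s t f : integrableC `]s, t[ f ->
  primitiveC s t (fun x => intC `]s, x[ f) f.
Proof.
move=> [rf jf]; split; apply: (@Rintegral_primitive _ _ _ _ _ 0) => // x xst;
  by rewrite add0r -(Rintegral_oo_cc _ xst).
Qed.

Lemma cvg_primitive_right s t (f : R -> R) : s < t ->
  mu.-integrable `]s, t[ (EFin \o f) ->
  \int[mu]_(r in `]s, x[) f r @[x --> s^'+] --> (0 : R).
Proof.
move=> st fi.
have := parameterized_integral_cvg_left st (integrable_itv_oo_cc fi).
move=> /cvg_at_right_filter; apply: cvg_trans; apply: near_eq_cvg.
near=> x; apply/esym/(Rintegral_oo_cc fi); apply/andP; split; near: x.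
  exact: nbhs_right_gt.
exact: nbhs_right_lt.
Unshelve. all: by end_near. Qed.

Lemma cvg_primitive_left s t (f : R -> R) : s < t ->
  mu.-integrable `]s, t[ (EFin \o f) ->
  \int[mu]_(r in `]s, x[) f r @[x --> t^'-] --> \int[mu]_(r in `]s, t[) f r.
Proof.
move=> st fi.
have -> : \int[mu]_(r in `]s, t[) f r = \int[mu]_(r in `[s, t]) f r.
  rewrite Rintegral_itv_bndo_bndc // Rintegral_itv_obnd_cbnd //.
  by apply: integrableS (integrable_itv_oo_cc fi) => //; apply: subset_itvr; rewrite bnd_simp.
have := parameterized_integral_cvg_at_left st (integrable_itv_oo_cc fi).
apply: cvg_trans; apply: near_eq_cvg.
near=> x; apply/esym/(Rintegral_oo_cc fi); apply/andP; split; near: x.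
  exact: nbhs_left_gt.
exact: nbhs_left_lt.
Unshelve. all: by end_near. Qed.

Lemma cvgC_primitive_right s t f : s < t -> integrableC `]s, t[ f ->
  cvgC s^'+ (fun x => intC `]s, x[ f) 0.
Proof. by move=> st [rf jf]; split; [exact: cvg_primitive_right st rf|exact: cvg_primitive_right st jf]. Qed.

Lemma cvgC_primitive_left s t f : s < t -> integrableC `]s, t[ f ->
  cvgC t^'- (fun x => intC `]s, x[ f) (intC `]s, t[ f).
Proof. by move=> st [rf jf]; split; [exact: cvg_primitive_left st rf|exact: cvg_primitive_left st jf]. Qed.

Lemma intC_tail s t f x : s < x < t -> integrableC `]s, t[ f ->
  intC `]x, t[ f = intC `]s, t[ f - intC `]s, x[ f.
Proof.
move=> /andP[sx xt] fi; rewrite (intC_glue sx xt); first by rewrite addrC addKr.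
- apply: (integrableCS _ _ _ fi) => //; apply: subset_itvl; rewrite bnd_simp; exact: ltW.
- apply: (integrableCS _ _ _ fi) => //; apply: subset_itvr; rewrite bnd_simp; exact: ltW.
Qed.

End complexL2.

(** * Wronskians and variation of parameters *)

Section ODE.
Context {R : realType}.
Implicit Types (s t x m : R) (D : set R) (q u v y z w F G f g h : R -> R[i]) (lam k : R[i]).
Notation mu := (@lebesgue_measure R).

Lemma primitiveC_eq_ae s t F f g : integrableC `]s, t[ g -> eqae `]s, t[ f g ->
  primitiveC s t F f -> primitiveC s t F g.
Proof.
move=> [rg jg] fg [rF jF]; split.
- apply: primitive_eq_ae rF; first by apply/measurable_EFinP; exact: (measurable_int mu rg).
  by apply: ae_imply fg => x fgx /fgx; rewrite /reF => ->.
- apply: primitive_eq_ae jF; first by apply/measurable_EFinP; exact: (measurable_int mu jg).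
  by apply: ae_imply fg => x fgx /fgx; rewrite /imF => ->.
Qed.

(** The uniqueness principle that makes Wronskians constant. *)
Lemma primitiveC0_const s t F : primitiveC s t F (fun=> 0) ->
  forall x1 x2, s < x1 < t -> s < x2 < t -> F x1 = F x2.
Proof.
move=> /[dup] acF [rF jF].
suff H x1 x2 : s < x1 -> x1 <= x2 -> x2 < t -> F x1 = F x2.
  move=> x1 x2 /andP[sx1 x1t] /andP[sx2 x2t].
  by case: (leP x1 x2) => [|/ltW] x12; [|symmetry]; exact: H.
move=> sx1 x12 x2t; apply/esym/eqP; rewrite -subr_eq0.
have := rF.2 _ _ sx1 x12 x2t; have := jF.2 _ _ sx1 x12 x2t.
have E : \int[mu]_(x in `[x1, x2]) (0 : R) = 0 by rewrite /Rintegral integral0.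
rewrite {1}/imF {1}/reF /= !E /imF /reF.
case: (F x2) (F x1) => [a b] [c d] /= bd primitive.
by rewrite eq_complex /= bd primitive !eqxx.
Qed.

(** The Wronskian as a function of x, whereas [wronskian] is its left limit at 0. *)
Definition wronskian_at u v x := u x * cderiv v x - cderiv u x * v x.

Definition hom_sol q lam s t y :=
  W2 s t y /\ eqae `]s, t[ (ell q y) (fun x => lam * y x).

(** The equation ell y = lam y in the form y'' = (q - lam) y for the density y''. *)
Lemma hom_sol_jet q lam s t y : hom_sol q lam s t y ->
  exists2 w, jet2 s t y (cderiv y) w &
    eqae `]s, t[ w (fun x => (q x - lam) * y x).
Proof.
move=> [/W2_jet[w J] yE]; exists w => //.
apply: ae_imply2 yE (jet_ell q J) => x yx wx xst.
by move: (wx xst); rewrite yx // mulrBl => ->; ring.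
Qed.

(** The product rule gives the density u v'' - u'' v, which vanishes almost
    everywhere because y'' = (q - lam) y for both functions. *)
Lemma wronskian_at_const q lam s t u v : hom_sol q lam s t u -> hom_sol q lam s t v ->
  forall x1 x2, s < x1 < t -> s < x2 < t -> wronskian_at u v x1 = wronskian_at u v x2.
Proof.
move=> /hom_sol_jet[wu [u1 u2] uE] /hom_sol_jet[wv [v1 v2] vE].
apply: primitiveC0_const.
apply: primitiveC_eq_ae (primitiveCD (primitiveCM u1 v2) (primitiveCN (primitiveCM u2 v1))).
  by split; exact: integrable0.
apply: ae_imply2 uE vE => x ux vx xst.
by rewrite ux // vx //; ring.
Qed.

Lemma wronskian_at_limp q lam s t u v : hom_sol q lam s t u -> hom_sol q lam s t v ->
  forall x, s < x < t ->
  wronskian_at u v x = limp u s * limp (cderiv v) s - limp (cderiv u) s * limp v s.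
Proof.
move=> us vs x xst; have st : s < t by case/andP: xst => /lt_trans; apply.
have [wu [u1 u2] _] := hom_sol_jet us; have [wv [v1 v2] _] := hom_sol_jet vs.
pose proof (cvgCD (cvgCM (primitiveC_limp st u1) (primitiveC_limp st v2))
   (cvgCN (cvgCM (primitiveC_limp st u2) (primitiveC_limp st v1)))) as H.
apply: (cvgC_unique _ H).
apply: (cvgC_eq_right st _ (cvgC_cst _)) => r rst.
exact: (wronskian_at_const us vs xst rst).
Qed.

Lemma wronskian_at_limm q lam s t u v : hom_sol q lam s t u -> hom_sol q lam s t v ->
  forall x, s < x < t ->
  wronskian_at u v x = limm u t * limm (cderiv v) t - limm (cderiv u) t * limm v t.
Proof.
move=> us vs x xst; have st : s < t by case/andP: xst => /lt_trans; apply.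
have [wu [u1 u2] _] := hom_sol_jet us; have [wv [v1 v2] _] := hom_sol_jet vs.
pose proof (cvgCD (cvgCM (primitiveC_limm st u1) (primitiveC_limm st v2))
   (cvgCN (cvgCM (primitiveC_limm st u2) (primitiveC_limm st v1)))) as H.
apply: (cvgC_unique _ H).
apply: (cvgC_eq_left st _ (cvgC_cst _)) => r rst.
exact: (wronskian_at_const us vs xst rst).
Qed.

Section variation.
Variables (q u v h : R -> R[i]) (lam k A B : R[i]) (s t : R).
Hypotheses (st : s < t) (us : hom_sol q lam s t u) (vs : hom_sol q lam s t v)
  (hi : integrableC `]s, t[ h)
  (kW : forall x, s < x < t -> k * wronskian_at u v x = 1).

Let U x := A + intC `]s, x[ (fun r => h r * u r).
Let V x := B + intC `]x, t[ (fun r => h r * v r).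

(** Variation of parameters on one side of 0.  The constants A and B account for
    the integrals over the other side of 0. *)
Definition varparam x := k * (v x * U x + u x * V x).
(** The derivative of [varparam]: the terms with U' = h u and V' = - h v cancel. *)
Definition varparam' x := k * (cderiv v x * U x + cderiv u x * V x).

Lemma solution_integrable y : hom_sol q lam s t y ->
  integrableC `]s, t[ (fun r => h r * y r).
Proof. by move=> /hom_sol_jet[w [y1 _] _]; exact: integrableCM_primitiveC y1 hi. Qed.

Lemma primitiveC_U : primitiveC s t U (fun x => h x * u x).
Proof.
apply: (primitiveC_eq _ _ (primitiveCD (primitiveC_cst s t A) (primitiveC_intC (solution_integrable us)))) => // x _.
by rewrite add0r.
Qed.

Let VE x : s < x < t -> V x = B + (intC `]s, t[ (fun r => h r * v r)
   - intC `]s, x[ (fun r => h r * v r)).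
Proof. by move=> xst; rewrite /V (intC_tail xst (solution_integrable vs)). Qed.

Lemma primitiveC_V : primitiveC s t V (fun x => - (h x * v x)).
Proof.
apply: (primitiveC_eq _ _ (primitiveCD (primitiveC_cst s t B) (primitiveCD (primitiveC_cst s t _)
  (primitiveCN (primitiveC_intC (solution_integrable vs)))))) => x xst.
  exact/esym/VE.
by rewrite !add0r.
Qed.

(** Differentiating once, the contributions v h u and - u h v cancel.
    Differentiating twice, they become h times the Wronskian, which k cancels. *)
Lemma varparam_jet : exists2 w, jet2 s t varparam varparam' w &
  eqae `]s, t[ (fun x => lam * varparam x - (- w x + q x * varparam x)) h.
Proof.
have [wu [u1 u2] uE] := hom_sol_jet us; have [wv [v1 v2] vE] := hom_sol_jet vs.
have U1 := primitiveC_U; have V1 := primitiveC_V.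
pose w x := k * (wv x * U x + wu x * V x) + h x.
exists w; last first.
  apply: ae_imply2 uE vE => x ux vx xst; rewrite /w /varparam ux // vx //; ring.
split.
- apply: primitiveC_eq (primitiveCM (primitiveC_cst s t k) (primitiveCD (primitiveCM v1 U1) (primitiveCM u1 V1))) => // x _.
  by rewrite /varparam'; ring.
- apply: primitiveC_eq (primitiveCM (primitiveC_cst s t k) (primitiveCD (primitiveCM v2 U1) (primitiveCM u2 V1))) => // x xst.
  have := kW xst; rewrite /wronskian_at /w => kW1.
  rewrite -[X in _ = _ + X]mulr1 -kW1; ring.
Qed.

Lemma varparam_limp : cvgC s^'+ varparam
    (k * (limp v s * A + limp u s * (B + intC `]s, t[ (fun r => h r * v r)))) /\
  cvgC s^'+ varparam' (k * (limp (cderiv v) s * A +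
     limp (cderiv u) s * (B + intC `]s, t[ (fun r => h r * v r)))).
Proof.
have [wu [u1 u2] uE] := hom_sol_jet us; have [wv [v1 v2] vE] := hom_sol_jet vs.
have UL : cvgC s^'+ U A.
  rewrite -[A]addr0.
  exact: (cvgCD (cvgC_cst A) (cvgC_primitive_right st (solution_integrable us))).
have VL : cvgC s^'+ V (B + intC `]s, t[ (fun r => h r * v r)).
  pose proof (cvgCD (cvgC_cst B) (cvgCD (cvgC_cst (intC `]s, t[ (fun r => h r * v r)))
    (cvgCN (cvgC_primitive_right st (solution_integrable vs))))) as H.
  rewrite -[intC _ _]subr0; apply: (cvgC_eq_right st _ H) => x /VE ->.
  by [].
split.
- exact: (cvgCM (cvgC_cst k) (cvgCD (cvgCM (primitiveC_limp st v1) UL) (cvgCM (primitiveC_limp st u1) VL))).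
- exact: (cvgCM (cvgC_cst k) (cvgCD (cvgCM (primitiveC_limp st v2) UL) (cvgCM (primitiveC_limp st u2) VL))).
Qed.

Lemma varparam_limm : cvgC t^'- varparam
    (k * (limm v t * (A + intC `]s, t[ (fun r => h r * u r)) + limm u t * B)) /\
  cvgC t^'- varparam' (k * (limm (cderiv v) t * (A + intC `]s, t[ (fun r => h r * u r))
    + limm (cderiv u) t * B)).
Proof.
have [wu [u1 u2] uE] := hom_sol_jet us; have [wv [v1 v2] vE] := hom_sol_jet vs.
have UL : cvgC t^'- U (A + intC `]s, t[ (fun r => h r * u r)).
  exact: (cvgCD (cvgC_cst A) (cvgC_primitive_left st (solution_integrable us))).
have VL : cvgC t^'- V B.
  pose proof (cvgCD (cvgC_cst B) (cvgCD (cvgC_cst (intC `]s, t[ (fun r => h r * v r)))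
    (cvgCN (cvgC_primitive_left st (solution_integrable vs))))) as H.
  rewrite subrr addr0 in H; apply: (cvgC_eq_left st _ H) => x /VE ->.
  by [].
split.
- exact: (cvgCM (cvgC_cst k) (cvgCD (cvgCM (primitiveC_limm st v1) UL) (cvgCM (primitiveC_limm st u1) VL))).
- exact: (cvgCM (cvgC_cst k) (cvgCD (cvgCM (primitiveC_limm st v2) UL) (cvgCM (primitiveC_limm st u2) VL))).
Qed.

End variation.
End ODE.

(** * Partial fractions and the reciprocal of a rational function *)

Section PartialFractions.
Context {F : numFieldType}.
Implicit Types (p : {poly F}) (z : F).

(** [pf_num] and [pf_den] are the numerator and denominator of the rational
    function p + sum of rho_i / (z - c_i). *)
Definition pf_den n (c : 'I_n -> F) : {poly F} := \prod_i ('X - (c i)%:P).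
Definition pf_num n p (c rho : 'I_n -> F) : {poly F} :=
  p * pf_den c + \sum_i rho i *: \prod_(j | j != i) ('X - (c j)%:P).

Lemma pf_den_eq0 n (c : 'I_n -> F) z :
  ((pf_den c).[z] == 0) = [exists i, z == c i].
Proof.
rewrite horner_prod; apply/idP/existsP => [/prodf_eq0[i _]|[i /eqP->]].
  by rewrite !hornerE subr_eq0; exists i.
by apply/prodf_eq0; exists i => //; rewrite !hornerE subrr.
Qed.

Lemma pf_evalE n p (c rho : 'I_n -> F) z : (forall i, z != c i) ->
  p.[z] + \sum_i rho i / (z - c i) = (pf_num p c rho).[z] / (pf_den c).[z].
Proof.
move=> zc; have D0 : (pf_den c).[z] != 0.
  by rewrite pf_den_eq0 negb_exists; apply/forallP.
rewrite /pf_num hornerD hornerM mulrDl mulfK //; congr (_ + _).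
rewrite horner_sum mulr_suml; apply: eq_bigr => i _.
have zi : z - c i != 0 by rewrite subr_eq0.
have DE : (pf_den c).[z] =
    (z - c i) * (\prod_(j < n | j != i) ('X - (c j)%:P)).[z].
  by rewrite /pf_den (bigD1 i) //= hornerM !hornerE.
move: D0; rewrite hornerZ DE mulf_eq0 negb_or => /andP[_ P0].
by field; rewrite P0 zi.
Qed.

(** Numerator and denominator have no common zero: at c_i only one summand of the
    numerator survives, and it is rho_i times the product of the c_i - c_j. *)
Lemma pf_num_pole n p (c rho : 'I_n -> F) i : injective c -> rho i != 0 ->
  (pf_num p c rho).[c i] != 0.
Proof.
move=> ci ri; rewrite /pf_num hornerD hornerM.
have /eqP-> : (pf_den c).[c i] == 0 by rewrite pf_den_eq0; apply/existsP; exists i.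
rewrite mulr0 add0r horner_sum (bigD1 i) //= [X in _ + X]big1 ?addr0; last first.
  move=> j ji; rewrite hornerZ horner_prod (bigD1 i) 1?eq_sym //=.
  by rewrite hornerXsubC subrr mul0r mulr0.
rewrite hornerZ mulf_neq0 // horner_prod; apply/prodf_neq0 => j ji.
by rewrite hornerXsubC subr_eq0; apply: contra_neq ji => /ci.
Qed.

(** Without poles the numerator is p; with poles it is nonzero at each of them. *)
Lemma pf_num_neq0 n p (c rho : 'I_n -> F) : injective c ->
  (forall i, rho i != 0) -> p != 0 -> pf_num p c rho != 0.
Proof.
case: n c rho => [|n] c rho ci r0 p0.
  by rewrite /pf_num /pf_den !big_ord0 mulr1 addr0.
apply: contraTneq (pf_num_pole p ci (r0 ord0)) => ->.
by rewrite horner0 eqxx.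
Qed.

Lemma poly_eval_eq0 p : (forall z, p.[z] = 0) -> p = 0.
Proof.
move=> p0; apply: (@roots_geq_poly_eq0 _ p [seq i%:R | i <- iota 0 (size p)]).
- by apply/allP => z _; rewrite /root p0.
- by rewrite map_inj_uniq ?iota_uniq // => i j /eqP; rewrite eqr_nat => /eqP.
- by rewrite size_map size_iota.
Qed.

(** An expansion of the reciprocal that is valid wherever both sides are defined
    is, once denominators are cleared, an identity of polynomials: it holds off
    the zeros of the three nonzero polynomials by which E is multiplied below. *)
Lemma pf_inv n n' p p' (c rho : 'I_n -> F) (c' rho' : 'I_n' -> F) :
  injective c -> (forall i, rho i != 0) -> p != 0 ->
  (forall z, (forall i, z != c i) -> p.[z] + \sum_i rho i / (z - c i) != 0 ->
     (forall i, z != c' i) ->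
     (p.[z] + \sum_i rho i / (z - c i))^-1 = p'.[z] + \sum_i rho' i / (z - c' i)) ->
  pf_den c * pf_den c' = pf_num p c rho * pf_num p' c' rho'.
Proof.
move=> ci r0 p0 inv; apply/eqP; rewrite -subr_eq0.
set E := _ - _.
have A0 := pf_num_neq0 ci r0 p0.
have dn0 m (e : 'I_m -> F) : pf_den e != 0.
  by apply/prodf_neq0 => i _; rewrite polyXsubC_eq0.
suff : E * (pf_num p c rho * (pf_den c * pf_den c')) == 0.
  by rewrite !mulf_eq0 (negPf A0) !(negPf (dn0 _ _)) !orbF.
apply/eqP/poly_eval_eq0 => z; rewrite !hornerM.
have [->|Az] := eqVneq (pf_num p c rho).[z] 0; first by rewrite mul0r mulr0.
have [->|Bz] := eqVneq (pf_den c).[z] 0; first by rewrite mul0r !mulr0.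
have [->|Dz] := eqVneq (pf_den c').[z] 0; first by rewrite !mulr0.
have zc i : z != c i.
  by move: Bz; rewrite pf_den_eq0 negb_exists => /forallP/(_ i).
have zc' i : z != c' i.
  by move: Dz; rewrite pf_den_eq0 negb_exists => /forallP/(_ i).
have := inv z zc; rewrite !pf_evalE // => /(_ _ zc').
rewrite mulf_neq0 ?invr_eq0 // => /(_ isT) H.
suff -> : E.[z] = 0 by rewrite mul0r.
rewrite /E hornerD hornerN !hornerM; apply/eqP; rewrite subr_eq0; apply/eqP.
by move/eqP: H; rewrite invf_div eqr_div // [RHS]mulrC => /eqP.
Qed.

(** Here r denotes the rational function p + sum of rho_i / (z - c_i) and r* the
    given expansion of 1/r.  The relation d = r(z) x, read as x = 0 at a pole
    of r, is the same as x = r*(z) d, read as d = 0 at a pole of r*.  In terms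
    of the polynomial identity of [pf_inv]: a pole of r is a zero of r*, a pole
    of r* is a zero of r, and there are no others. *)
Lemma pf_inv_jump n n' p p' (c rho : 'I_n -> F) (c' rho' : 'I_n' -> F) z x d :
  injective c -> (forall i, rho i != 0) -> p != 0 ->
  injective c' -> (forall i, rho' i != 0) ->
  (forall z, (forall i, z != c i) -> p.[z] + \sum_i rho i / (z - c i) != 0 ->
     (forall i, z != c' i) ->
     (p.[z] + \sum_i rho i / (z - c i))^-1 = p'.[z] + \sum_i rho' i / (z - c' i)) ->
  ((forall i, z != c i) -> d = (p.[z] + \sum_i rho i / (z - c i)) * x) ->
  ((exists i, z = c i) -> x = 0) ->
  ((forall i, z != c' i) -> x = (p'.[z] + \sum_i rho' i / (z - c' i)) * d) /\
  ((exists i, z = c' i) -> d = 0).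
Proof.
move=> ci r0 p0 ci' r0' inv dE xE.
have /(congr1 (fun p => p.[z])) := pf_inv ci r0 p0 inv; rewrite !hornerM => H.
split=> [zc'|[i zi]].
- have Dz : (pf_den c').[z] != 0.
    by rewrite pf_den_eq0 negb_exists; apply/forallP.
  rewrite pf_evalE //; case: (boolP [exists i, z == c i]) => [/existsP[i /eqP zi]|].
    have x0 : x = 0 by apply: xE; exists i.
    suff -> : (pf_num p' c' rho').[z] = 0 by rewrite x0 !mul0r.
    move: H; have /eqP-> : (pf_den c).[z] == 0.
      by rewrite pf_den_eq0; apply/existsP; exists i; rewrite zi.
    rewrite mul0r => /esym/eqP; rewrite mulf_eq0 zi.
    by rewrite (negPf (pf_num_pole _ ci (r0 i))) => /eqP.
  rewrite negb_exists => /forallP zc; rewrite dE // pf_evalE //.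
  have Bz : (pf_den c).[z] != 0.
    by rewrite pf_den_eq0 negb_exists; apply/forallP.
  rewrite mulrA mulrACA [_ * (pf_num p c rho).[z]]mulrC -H.
  by field; rewrite Bz Dz.
- have : (pf_num p c rho).[z] * (pf_num p' c' rho').[z] == 0.
    rewrite -H; suff /eqP-> : (pf_den c').[z] == 0 by rewrite mulr0.
    by rewrite pf_den_eq0; apply/existsP; exists i; rewrite zi.
  rewrite mulf_eq0 orbC zi (negPf (pf_num_pole _ ci' (r0' i))) -zi /= => /eqP Az.
  have zc j : z != c j.
    apply/eqP => zj; move/eqP: Az; rewrite zj.
    by rewrite (negPf (pf_num_pole _ ci (r0 j))).
  by rewrite dE // pf_evalE // Az !mul0r.
Qed.

End PartialFractions.

(** * The finite-dimensional components of the resolvent *)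

Section Vectors.
Context {R : realType}.
Implicit Types (lam s r x d : R[i]).

Lemma dotC_vecC n (v : 'cV[R[i]]_n) (w : 'I_n -> R) :
  dotC v (vecC w) = \sum_i v i 0 * (w i)%:C.
Proof.
by apply: eq_bigr => i _; rewrite mxE; congr (_ * _); exact: conjc_real.
Qed.

Lemma diagC_mul n (p : 'I_n -> R) (v : 'cV[R[i]]_n) :
  diagC p *m v = \col_i ((p i)%:C * v i 0).
Proof. by apply/matrixP => i j; rewrite mul_diag_mx !mxE (ord1 j). Qed.

Section resolvent_vec.
Variables (n : nat) (p w : 'I_n -> R) (lam s r : R[i]).
Let f := resolvent_vec p w lam s r.

Lemma resolvent_vec_regular : (forall i, lam != (p i)%:C) ->
  f = \col_i (s * (w i)%:C / (lam - (p i)%:C)).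
Proof.
move=> lp; rewrite /f /resolvent_vec; case: pickP => [k /eqP lk|_].
  by have := lp k; rewrite lk eqxx.
have E : lam%:M - diagC p = diag_mx (\row_i (lam - (p i)%:C)).
  by apply/matrixP => i j; rewrite !mxE; case: eqP => [->|]; rewrite ?subrr ?mulr1n ?mulr0n ?subr0.
set M := lam%:M - diagC p.
have uM : M \in unitmx.
  rewrite /M E unitmxE det_diag unitfE; apply/prodf_neq0 => i _.
  by rewrite mxE subr_eq0.
rewrite -[RHS](mulKmx uM); congr (_ *m _).
rewrite /M E; apply/matrixP => i j; rewrite mul_diag_mx !mxE.
have := lp i; rewrite -subr_eq0 => l0; field.
exact: l0.
Qed.

Lemma resolvent_vec_singular k : injective p -> lam = (p k)%:C ->
  f = (r / (w k)%:C) *: delta_mx k 0.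
Proof.
move=> ip lk; rewrite /f /resolvent_vec; case: pickP => [l /eqP|/(_ k)].
  by rewrite lk => -[/ip ->].
by rewrite lk eqxx.
Qed.

(** The components solve the diagonal system (lam - p_i) f_i = s w_i; at a node
    it is solvable only for s = 0, and the entry at the node is then free. *)
Lemma resolvent_vec_eq : injective p -> ((exists k, lam = (p k)%:C) -> s = 0) ->
  lam *: f = s *: vecC w + diagC p *m f.
Proof.
move=> ip s0; rewrite diagC_mul.
case: (boolP [exists k, lam == (p k)%:C]) => [/existsP[k /eqP lk]|].
  rewrite (resolvent_vec_singular ip lk) s0; last by exists k.
  rewrite scale0r add0r; apply/matrixP => i j; rewrite !mxE (ord1 j) eqxx andbT.
  by case: eqP => [->|_]; rewrite ?lk // !mulr0.
rewrite negb_exists => /forallP lp; rewrite resolvent_vec_regular //.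
apply/matrixP => i j; rewrite !mxE.
have := lp i; rewrite -subr_eq0 => l0; field.
exact: l0.
Qed.

Lemma resolvent_vec_dot_regular : (forall i, lam != (p i)%:C) ->
  dotC f (vecC w) = (\sum_i (w i)%:C ^+ 2 / (lam - (p i)%:C)) * s.
Proof.
move=> lp; rewrite dotC_vecC resolvent_vec_regular // mulr_suml.
apply: eq_bigr => i _; rewrite mxE.
have := lp i; rewrite -subr_eq0 => l0; field.
exact: l0.
Qed.

(** This is how the free entry at a node is chosen: it makes the scalar product in
    the domain condition equal to the prescribed r. *)
Lemma resolvent_vec_dot_singular : injective p -> (forall i, 0 < w i) ->
  (exists k, lam = (p k)%:C) -> dotC f (vecC w) = r.
Proof.
move=> ip w0 [k lk]; rewrite dotC_vecC (resolvent_vec_singular ip lk).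
rewrite (bigD1 k) //= big1 ?addr0; last first.
  by move=> i /negPf ik; rewrite !mxE ik /= mulr0 mul0r.
rewrite !mxE !eqxx mulr1 mulfVK //.
by apply/eqP => -[wk]; have := w0 k; rewrite wk ltxx.
Qed.
End resolvent_vec.

Lemma increasing_injective n (p w : 'I_n -> R) : increasing_positive p w -> injective p.
Proof.
move=> [pi _] i j pij; apply/val_inj; case: (ltngtP i j) => // [/pi|/pi];
  by rewrite pij ltxx.
Qed.

Section jump.
Variables (P : problem R) (lam : R[i]).
Hypothesis hP : standing_assumptions P.

Let realC_inj n (p : 'I_n -> R) : injective p -> injective (fun i => (p i)%:C).
Proof. by move=> ip i j /= [] /ip. Qed.

Let posC n (w : 'I_n -> R) : (forall i, 0 < w i) -> forall i, (w i)%:C ^+ 2 != 0 :> R[i].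
Proof.
by move=> w0 i; rewrite sqrf_eq0; apply/eqP => -[wi]; have := w0 i; rewrite wi ltxx.
Qed.

Lemma muE z : mu P z = ((xi P)%:C%:P - (eta P)%:C *: 'X).[z] +
  \sum_i (@bres R P i)%:C ^+ 2 / (z - (@cpole R P i)%:C).
Proof. by rewrite /mu !hornerE; ring. Qed.

Lemma nuE z : nu P z = ((zeta P)%:C%:P + (kappa P)%:C *: 'X).[z] +
  \sum_i (- (@ares R P i)%:C ^+ 2) / (z - (@dpole R P i)%:C).
Proof.
rewrite /nu !hornerE; under [in RHS]eq_bigr do rewrite mulNr.
by rewrite sumrN; ring.
Qed.

(** Here x and d stand for y(0^+) and for the jump of y' at 0.  The two claims are
    the domain condition and the equation for the first finite component.  For
    eta = 0 the weights and nodes are those of mu; for eta > 0 they are those of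
    1/mu, and [pf_inv_jump] exchanges the roles of x and d. *)
Lemma component1_resolvent x d :
  (~ mu_pole P lam -> d = mu P lam * x) -> (mu_pole P lam -> x = 0) ->
  let f1 := resolvent_vec (node1 P) (weight1 P) lam
    (if 0 < eta P then d else x) (if 0 < eta P then - x else d) in
  (if 0 < eta P
   then - x + (sigma P)%:C * d - dotC f1 (vecC (weight1 P)) = 0
   else d - (xi P)%:C * x - dotC f1 (vecC (weight1 P)) = 0) /\
  lam *: f1 = (if 0 < eta P then d else x) *: vecC (weight1 P) + diagC (node1 P) *m f1.
Proof.
move=> dE xE.
have [cinc b0] := mu_data hP; have ci := increasing_injective (mu_data hP).
have eta0 := eta_ge0 hP.
have hT := inv_mu_data hP.
have hF : ~~ (0 < eta P) -> eta P = 0.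
  by rewrite -leNgt => e0; apply/eqP; rewrite eq_le e0.
have hT' : 0 < eta P -> eta P != 0 by move=> /gt_eqF ->.
move: hT hF hT'; rewrite /node1 /weight1 /Nstar.
case: (0 < eta P) => [/(_ isT) [ginc inv] _ /(_ isT) en0|_ /(_ isT) e0 _] /=.
- have [_ be0] := ginc; have gi := increasing_injective ginc.
  pose p : {poly R[i]} := (xi P)%:C%:P - (eta P)%:C *: 'X.
  have p0 : p != 0.
    apply/eqP => /(congr1 (fun r : {poly R[i]} => r`_1)).
    rewrite /p coefB coefC coefZ coefX coef0 /= sub0r mulr1 => /eqP.
    by rewrite oppr_eq0 => /eqP [] /eqP; exact/negP.
  have [] := @pf_inv_jump _ _ _ p (sigma P)%:C%:P
    (fun i => (@cpole R P i)%:C) (fun i => (@bres R P i)%:C ^+ 2) (fun i => (@gamma R P i)%:C)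
    (fun i => - (@beta R P i)%:C ^+ 2) lam x d (realC_inj ci) (posC b0) p0 (realC_inj gi).
  + by move=> i; rewrite oppr_eq0; exact: posC.
  + move=> z zc; rewrite -muE => mz zg; rewrite inv //; last first.
      by case=> i zi; have := zc i; rewrite zi eqxx.
    by rewrite hornerC -sumrN; congr (_ + _); apply: eq_bigr => i _; rewrite mulNr.
  + by move=> zc; rewrite -muE dE // => -[i zi]; have := zc i; rewrite zi eqxx.
  + exact: xE.
  move=> reg sing; split; last exact: resolvent_vec_eq.
  case: (boolP [exists k, lam == (@gamma R P k)%:C]) => [/existsP[k /eqP lk]|].
    rewrite resolvent_vec_dot_singular //; last by exists k.
    by rewrite sing ?mulr0; [ring|exists k].
  rewrite negb_exists => /forallP lg; rewrite resolvent_vec_dot_regular //.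
  rewrite {1}reg // hornerC; under eq_bigr do rewrite mulNr.
  by rewrite sumrN; ring.
- split; last exact: resolvent_vec_eq.
  case: (boolP [exists k, lam == (@cpole R P k)%:C]) => [/existsP[k /eqP lk]|].
    rewrite resolvent_vec_dot_singular //; last by exists k.
    by rewrite xE ?mulr0; [ring|exists k].
  rewrite negb_exists => /forallP lg; rewrite resolvent_vec_dot_regular //.
  rewrite dE; last by case=> k lk; have := lg k; rewrite lk eqxx.
  by rewrite /mu e0; ring.
Qed.

(** The counterpart of [component1_resolvent] for nu, with x = y'(0^-) and d the
    jump of y at 0; the signs of the residues are opposite. *)
Lemma component2_resolvent x d :
  (~ nu_pole P lam -> d = nu P lam * x) -> (nu_pole P lam -> x = 0) ->
  let f2 := resolvent_vec (node2 P) (weight2 P) lam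
    (if 0 < kappa P then d else x) (if 0 < kappa P then x else - d) in
  (if 0 < kappa P
   then x - (tau P)%:C * d - dotC f2 (vecC (weight2 P)) = 0
   else - d + (zeta P)%:C * x - dotC f2 (vecC (weight2 P)) = 0) /\
  lam *: f2 = (if 0 < kappa P then d else x) *: vecC (weight2 P) + diagC (node2 P) *m f2.
Proof.
move=> dE xE.
have [cinc b0] := nu_data hP; have ci := increasing_injective (nu_data hP).
have kappa0 := kappa_ge0 hP.
have hT := inv_nu_data hP.
have hF : ~~ (0 < kappa P) -> kappa P = 0.
  by rewrite -leNgt => e0; apply/eqP; rewrite eq_le e0.
have hT' : 0 < kappa P -> kappa P != 0 by move=> /gt_eqF ->.
move: hT hF hT'; rewrite /node2 /weight2 /Mstar.
case: (0 < kappa P) => [/(_ isT) [ginc inv] _ /(_ isT) en0|_ /(_ isT) e0 _] /=.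
- have [_ be0] := ginc; have gi := increasing_injective ginc.
  pose p : {poly R[i]} := (zeta P)%:C%:P + (kappa P)%:C *: 'X.
  have p0 : p != 0.
    apply/eqP => /(congr1 (fun r : {poly R[i]} => r`_1)).
    rewrite /p coefD coefC coefZ coefX coef0 /= add0r mulr1 => -[] /eqP.
    exact/negP.
  have [] := @pf_inv_jump _ _ _ p (tau P)%:C%:P
    (fun i => (@dpole R P i)%:C) (fun i => - (@ares R P i)%:C ^+ 2) (fun i => (@delta R P i)%:C)
    (fun i => (@alpha R P i)%:C ^+ 2) lam x d (realC_inj ci) _ p0 (realC_inj gi) (posC be0).
  + by move=> i; rewrite oppr_eq0; exact: posC.
  + move=> z zc; rewrite -nuE => mz zg; rewrite inv ?hornerC //.
    by case=> i zi; have := zc i; rewrite zi eqxx.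
  + by move=> zc; rewrite -nuE dE // => -[i zi]; have := zc i; rewrite zi eqxx.
  + exact: xE.
  move=> reg sing; split; last exact: resolvent_vec_eq.
  case: (boolP [exists k, lam == (@delta R P k)%:C]) => [/existsP[k /eqP lk]|].
    rewrite resolvent_vec_dot_singular //; last by exists k.
    by rewrite sing ?mulr0; [ring|exists k].
  rewrite negb_exists => /forallP lg; rewrite resolvent_vec_dot_regular //.
  by rewrite {1}reg // hornerC; ring.
- split; last exact: resolvent_vec_eq.
  case: (boolP [exists k, lam == (@dpole R P k)%:C]) => [/existsP[k /eqP lk]|].
    rewrite resolvent_vec_dot_singular //; last by exists k.
    by rewrite xE ?mulr0; [ring|exists k].
  rewrite negb_exists => /forallP lg; rewrite resolvent_vec_dot_regular //.
  rewrite dE; last by case=> k lk; have := lg k; rewrite lk eqxx.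
  by rewrite /nu e0; ring.
Qed.

End jump.
End Vectors.

(** * Solutions of the boundary value problem as elements of the domain *)

Section Resolvent.
Context {R : realType}.
Variables (P : problem R).
Implicit Types (s t x m : R) (y z u v h g : R -> R[i]) (lam k : R[i]).
Notation mu_L := (@lebesgue_measure R).
Notation q := (pq P).
Notation a := (pa P).
Notation b := (pb P).
Hypothesis hP : standing_assumptions P.

Let Na0 : - a < 0. Proof. by rewrite oppr_lt0; exact: a_gt0 hP. Qed.
Let b0 : 0 < b. Proof. exact: b_gt0 hP. Qed.

Definition inhom_sol lam s t h y :=
  W2 s t y /\ eqae `]s, t[ (fun x => lam * y x - ell q y x) h.

(** y(0^+) mu = Delta' y and y'(0^-) nu = Delta y, with their reading at poles. *)
Definition interface_conditions lam y :=
  [/\ ~ mu_pole P lam -> djump y = mu P lam * limp y 0,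
      mu_pole P lam -> limp y 0 = 0,
      ~ nu_pole P lam -> jump y = nu P lam * limm (cderiv y) 0
    & nu_pole P lam -> limm (cderiv y) 0 = 0].

Definition bvp lam h y :=
  [/\ inhom_sol lam (- a) 0 h y, inhom_sol lam 0 b h y, bc_left P y, bc_right P y
    & interface_conditions lam y].

(** The finite components are determined by y through the resolvent equation. *)
Definition sol_in_H lam y : H P :=
  (y : R -> R[i]^o,
   resolvent_vec (node1 P) (weight1 P) lam
    (if 0 < eta P then djump y else limp y 0)
    (if 0 < eta P then - limp y 0 else djump y),
   resolvent_vec (node2 P) (weight2 P) lam
    (if 0 < kappa P then jump y else limm (cderiv y) 0)
    (if 0 < kappa P then limm (cderiv y) 0 else - jump y)).

Lemma eqae_glue s m t f g : s < m -> m < t ->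
  eqae `]s, m[ f g -> eqae `]m, t[ f g -> eqae `]s, t[ f g.
Proof.
move=> sm mt fg1 fg2.
have ne : {ae mu_L, forall x, x != m}.
  exists [set m]; split => //=; first exact: lebesgue_measure_set1.
  by move=> x /= /negP; rewrite negbK => /eqP.
have fg : {ae mu_L, forall x, (`]s, m[%classic x -> f x = g x) /\
    (`]m, t[%classic x -> f x = g x)}.
  exact: ae_imply2 fg1 fg2.
apply: ae_imply2 ne fg => x xm [f1 f2] /=; rewrite in_itv /= => /andP[sx xt].
case: (ltgtP x m) => [xlm|mlx|xE]; last by rewrite xE eqxx in xm.
- by apply: f1; rewrite /= in_itv /= sx.
- by apply: f2; rewrite /= in_itv /= mlx.
Qed.

Lemma inhom_sol_maxdom lam s t h y : L2 `]s, t[ h -> inhom_sol lam s t h y -> maxdom P s t y.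
Proof.
move=> hL [yW yE]; have [w [y1 y2]] := W2_jet yW.
split => //; [exact: primitiveC_L2 y1|exact: primitiveC_L2 y2|].
exists (fun x => lam * y x + - h x).
  by apply: L2D; [apply: L2Z; exact: primitiveC_L2 y1|exact: L2N].
by apply: ae_imply yE => x yx /yx <-; ring.
Qed.

Lemma sol_in_H_resolvent lam h y : L2 `](- a), b[ h -> bvp lam h y ->
  dom (sol_in_H lam y) /\
  eqH (lam *: sol_in_H lam y - opL (sol_in_H lam y)) ((h : R -> R[i]^o, 0, 0) : H P).
Proof.
move=> hL [ym yp bl br [i1 i2 i3 i4]].
have hLm : L2 `](- a), 0[ h.
  by apply: L2S hL => //; apply: subset_itvl; rewrite bnd_simp ltW.
have hLp : L2 `]0, b[ h.
  by apply: L2S hL => //; apply: subset_itvr; rewrite bnd_simp ltW.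
have [c1 e1] := component1_resolvent hP i1 i2; have [c2 e2] := component2_resolvent hP i3 i4.
split.
  split => //=.
  - apply: (L2_glue Na0 b0).
      by have [] := inhom_sol_maxdom hLm ym.
    by have [] := inhom_sol_maxdom hLp yp.
  - by split => //; exact: inhom_sol_maxdom ym.
  - by split => //; exact: inhom_sol_maxdom yp.
split => /=.
- exact: (eqae_glue Na0 b0 ym.2 yp.2).
- by apply/eqP; rewrite subr_eq0; apply/eqP.
- by apply/eqP; rewrite subr_eq0; apply/eqP.
Qed.

(** None of these maps is additive on arbitrary functions, as limits and
    derivatives need not exist; on [W2] they are, [ell] almost everywhere. *)
Lemma W2B s t y z : s < t -> W2 s t y -> W2 s t z ->
  [/\ W2 s t (z - y),
      eqae `]s, t[ (ell q (z - y)) (fun x => ell q z x - ell q y x),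
      limp (z - y) s = limp z s - limp y s /\
      limp (cderiv (z - y)) s = limp (cderiv z) s - limp (cderiv y) s
    & limm (z - y) t = limm z t - limm y t /\
      limm (cderiv (z - y)) t = limm (cderiv z) t - limm (cderiv y) t].
Proof.
move=> st /W2_jet[wy Jy] /W2_jet[wz Jz].
have [y1 y2] := Jy; have [z1 z2] := Jz.
have J : jet2 s t (z - y) (fun x => cderiv z x + - cderiv y x) (fun x => wz x + - wy x).
  by split; [exact: primitiveCD z1 (primitiveCN y1)|exact: primitiveCD z2 (primitiveCN y2)].
have dE := jet_cderiv J.
split.
- exact: jet_W2 J.
- have zE := jet_ell q Jz; have yE := jet_ell q Jy.
  have E : {ae mu_L, forall x, (`]s, t[%classic x -> ell q z x = - wz x + q x * z x) /\
    (`]s, t[%classic x -> ell q y x = - wy x + q x * y x)}.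
    exact: ae_imply2 zE yE.
  apply: ae_imply2 (jet_ell q J) E => x Jx [zx yx] xst.
  rewrite Jx // zx // yx //.
  have -> : (z - y) x = z x - y x by [].
  by ring.
- split; apply: limpE.
    exact: (cvgCD (primitiveC_limp st z1) (cvgCN (primitiveC_limp st y1))).
  apply: (cvgC_eq_right st _ (cvgCD (primitiveC_limp st z2) (cvgCN (primitiveC_limp st y2)))).
  by move=> x /dE.
- split; apply: limmE.
    exact: (cvgCD (primitiveC_limm st z1) (cvgCN (primitiveC_limm st y1))).
  apply: (cvgC_eq_left st _ (cvgCD (primitiveC_limm st z2) (cvgCN (primitiveC_limm st y2)))).
  by move=> x /dE.
Qed.

Lemma maxdomB s t y z : s < t -> maxdom P s t y -> maxdom P s t z ->
  maxdom P s t (z - y).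
Proof.
move=> st [yW yL y'L [fy fyL fyE]] [zW zL z'L [fz fzL fzE]].
have [W E _ _] := W2B st yW zW.
split; first exact: W.
- exact: L2D zL (L2N yL).
- have [w [_ d2]] := W2_jet W; exact: primitiveC_L2 d2.
- exists (fun x => fz x + - fy x); first exact: L2D fzL (L2N fyL).
  have E2 : {ae mu_L, forall x, (`]s, t[%classic x -> ell q z x = fz x) /\
    (`]s, t[%classic x -> ell q y x = fy x)}.
    exact: ae_imply2 fzE fyE.
  by apply: ae_imply2 E E2 => x Ex [zx yx] xst; rewrite Ex // zx // yx.
Qed.

Lemma dotCB n (u v w : 'cV[R[i]]_n) : dotC (u - v) w = dotC u w - dotC v w.
Proof.
by rewrite /dotC -sumrB; apply: eq_bigr => i _; rewrite !mxE mulrBl.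
Qed.

Lemma domB (Y Z : H P) : dom Y -> dom Z ->
  dom (Z - Y) /\ eqH (opL (Z - Y)) (opL Z - opL Y).
Proof.
move: Y Z => [[y y1] y2] [[z z1] z2] [/= yL [ym bly] [yp bry] cy1 cy2]
  [/= zL [zm blz] [zp brz] cz1 cz2].
have [_ Em [la la'] [lm lm']] := W2B Na0
  (let: And4 w _ _ _ := ym in w) (let: And4 w _ _ _ := zm in w).
have [_ Ep [lp lp'] [lb lb']] := W2B b0
  (let: And4 w _ _ _ := yp in w) (let: And4 w _ _ _ := zp in w).
have swap (r1 r2 r3 r4 : R[i]) : (r1 - r2) - (r3 - r4) = (r1 - r3) - (r2 - r4).
  by ring.
have jE : jump (z - y) = jump z - jump y.
  by rewrite /jump lp lm; exact: swap.
have dE : djump (z - y) = djump z - djump y.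
  transitivity ((limp (cderiv z) 0 - limp (cderiv y) 0) -
      (limm (cderiv z) 0 - limm (cderiv y) 0)).
    exact: (congr2 (fun r1 r2 => r1 - r2) lp' lm').
  rewrite /djump; exact: swap.
split.
- split => /=.
  + exact: L2D zL (L2N yL).
  + split; first exact: maxdomB.
    by rewrite /bc_left la la' !mulrBl blz bly.
  + split; first exact: maxdomB.
    by rewrite /bc_right lb lb' !mulrBl brz bry.
  + rewrite dE lp dotCB; move: cy1 cz1.
    move: (dotC y1 _) (dotC z1 _) (limp y 0) (limp z 0) (djump y) (djump z).
    move=> ? ? ? ? ? ?.
    case: ifP => _ cy cz; have := congr2 (fun r1 r2 => r1 - r2) cz cy;
      by rewrite subrr => <-; ring.
  + rewrite jE lm' dotCB; move: cy2 cz2.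
    move: (dotC y2 _) (dotC z2 _) (limm (cderiv y) 0) (limm (cderiv z) 0).
    move=> ? ? ? ?; move: (jump y) (jump z) => ? ?.
    case: ifP => _ cy cz; have := congr2 (fun r1 r2 => r1 - r2) cz cy;
      by rewrite subrr => <-; ring.
- split => /=.
  + exact: (eqae_glue Na0 b0 Em Ep).
  + rewrite dE lp mulmxBr; case: ifP => _; rewrite scalerBl opprD addrACA //.
  + rewrite jE lm' mulmxBr; case: ifP => _; rewrite scalerBl opprD addrACA //.
Qed.

Lemma subr_exchange (V : zmodType) (x1 x2 y1 y2 c : V) :
  x1 - y1 = c -> x2 - y2 = c -> y1 - y2 = x1 - x2.
Proof.
move=> <- /eqP; rewrite subr_eq addrAC => /eqP ->.
by rewrite opprB addrCA opprD [x1 + _]addrA subrr add0r.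
Qed.

(** If Z - Y were not zero it would be an eigenvector. *)
Lemma resolvent_unique lam (F Y Z : H P) : ~ eigenvalueL P lam ->
  dom Y -> eqH (lam *: Y - opL Y) F -> dom Z -> eqH (lam *: Z - opL Z) F -> eqH Z Y.
Proof.
case: Y Z F => [[y y1] y2] [[z z1] z2] [[f f1] f2].
move=> ne dY [/= Y1 Y2 Y3] dZ [/= Z1 Z2 Z3].
have [dD [/= D1 D2 D3]] := domB dY dZ.
have {}Y1 : eqae `](- a), b[ (fun x => lam * y x - ell q y x) f := Y1.
have {}Z1 : eqae `](- a), b[ (fun x => lam * z x - ell q z x) f := Z1.
have {}D1 : eqae `](- a), b[ (ell q (z - y)) (fun x => ell q z x - ell q y x) := D1.
have [E|nE] := pselect (eqH ((z, z1, z2) - (y, y1, y2) : H P) 0).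
  case: E => /= E1 E2 E3; split => /=.
  - have {}E1 : eqae `](- a), b[ (fun x => z x - y x) (fun=> 0) := E1.
    by apply: ae_imply E1 => x Ex /Ex /eqP; rewrite subr_eq0 => /eqP.
  - by apply/eqP; rewrite -subr_eq0; apply/eqP.
  - by apply/eqP; rewrite -subr_eq0; apply/eqP.
exfalso; apply: ne; exists ((z, z1, z2) - (y, y1, y2)); split => //; split => /=.
- suff : eqae `](- a), b[ (ell q (z - y)) (fun x => lam * (z x - y x)) by [].
  have E : {ae mu_L, forall x,
    (`](- a), b[%classic x -> lam * y x - ell q y x = f x) /\
    (`](- a), b[%classic x -> lam * z x - ell q z x = f x)}.
    apply: ae_imply2 Y1 Z1 => x; exact: conj.
  apply: ae_imply2 D1 E => x Dx [Yx Zx] xab; rewrite (Dx xab).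
  have {Yx Zx} := congr2 (fun r1 r2 => r1 - r2) (Zx xab) (Yx xab).
  move: (ell q z x) (ell q y x) (z x) (y x) => ez ey zx yx.
  rewrite subrr => E0; apply/eqP; rewrite -subr_eq0 -oppr_eq0 -E0; apply/eqP.
  by ring.
- by rewrite D2 scalerBr; exact: subr_exchange Z2 Y2.
- by rewrite D3 scalerBr; exact: subr_exchange Z3 Y3.
Qed.
End Resolvent.

(** * Green's operator solves the boundary value problem *)

Section Green.
Context {R : realType}.
Variables (P : problem R).
Implicit Types (s t x m : R) (y z u v h g : R -> R[i]) (lam k : R[i]).
Notation mu_L := (@lebesgue_measure R).
Notation q := (pq P).
Notation a := (pa P).
Notation b := (pb P).
Hypothesis hP : standing_assumptions P.

Let Na0 : - a < 0. Proof. by rewrite oppr_lt0; exact: a_gt0 hP. Qed.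
Let b0 : 0 < b. Proof. exact: b_gt0 hP. Qed.

(** The transfer relation between the jets at 0^- and 0^+ in scalar form. *)
Definition transfers lam y :=
  limp y 0 = limm y 0 + nu P lam * limm (cderiv y) 0 /\
  limp (cderiv y) 0 =
    mu P lam * limm y 0 + (1 + mu P lam * nu P lam) * limm (cderiv y) 0.

Lemma transferP lam y : jetp y = transfer P lam *m jetm y -> transfers lam y.
Proof.
rewrite /jetp /transfer /jetm mul_block_col -!scalar_mxM -!raddfD /=.
move=> /eq_col_mx[] /(congr1 (fun A : 'M[R[i]]_1 => A 0 0)) E1
   /(congr1 (fun A : 'M[R[i]]_1 => A 0 0)) E2; move: E1 E2.
by rewrite !mxE eqxx !mulr1n mul1r.
Qed.

(** The inverse is explicit because the determinant is 1. *)
Lemma transfer_unit lam : transfer P lam \in unitmx.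
Proof.
pose T' : 'M[R[i]]_(1 + 1) := block_mx (1 + mu P lam * nu P lam)%:M
   (- nu P lam)%:M (- mu P lam)%:M 1%:M.
suff /mulmx1_unit[] : transfer P lam *m T' = 1%:M by [].
rewrite /transfer /T' mulmx_block -!scalar_mxM -!raddfD /=.
rewrite [RHS]scalar_mx_block.
by congr block_mx; rewrite -?(raddf0 (@scalar_mx _ 1)); congr (_%:M); ring.
Qed.

Lemma is_v_transfers lam v : is_v P lam v -> transfers lam v.
Proof.
move=> [_ _ _ _ vT]; apply: transferP.
by rewrite vT mulmxA mulmxV ?transfer_unit // mul1mx.
Qed.

Lemma transfers_interface_conditions lam y : ~ mu_pole P lam -> ~ nu_pole P lam ->
  transfers lam y -> interface_conditions P lam y.
Proof.
move=> nm nn [T1 T2]; split => // _.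
- by rewrite /djump T2 T1; move: (limm y 0) (limm _ _) => ? ?; ring.
- by rewrite /jump T1; move: (limm y 0) (limm _ _) => ? ?; ring.
Qed.

(** The integral of F from s is a primitive of F and, as F is zero almost
    everywhere, also a primitive of 0; its derivative is therefore both F and 0. *)
Lemma primitiveC_ae0 s t F f : primitiveC s t F f -> eqae `]s, t[ F (fun=> 0) ->
  forall x, s < x < t -> F x = 0.
Proof.
move=> acF F0 x xst.
have st : s < t by case/andP: xst => /lt_trans; apply.
have FI : integrableC `]s, t[ F by apply: L2_integrable; exact: primitiveC_L2 acF.
have G1 := primitiveC_intC FI.
have I0 : integrableC `]s, t[ (fun=> 0 : R[i]) by split; exact: integrable0.
have G0 := primitiveC_eq_ae I0 F0 G1.
have [_ _ <-] := primitiveC_cderiv xst G1 acF.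
by have [_ _ ->] := primitiveC_cderiv xst G0 (primitiveC_cst _ _ 0).
Qed.

Lemma intC_kernel s t (K f : R -> R[i]) c : (forall r, s < r < t -> K r = c * f r) ->
  integrableC `]s, t[ f ->
  integrableC `]s, t[ K /\ intC `]s, t[ K = c * intC `]s, t[ f.
Proof.
move=> KE fi; split.
- apply: integrableC_eq (integrableCZ c _ fi) => //.
  by move=> r; rewrite /= in_itv /= => /KE ->.
- rewrite -intCZ //; apply: intC_eq => r.
  by rewrite /= in_itv /= => /KE.
Qed.

(** The initial values at b are only used to see that v is not zero: otherwise
    both sin and cos of the boundary angle would vanish. *)
Lemma eigen_bvp lam v : bvp P lam (fun=> 0) v ->
  limm v b = (sin (bcr P))%:C -> limm (cderiv v) b = (cos (bcr P))%:C ->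
  eigenvalueL P lam.
Proof.
move=> vP vb v'b.
have h0 : L2 `](- a), b[ (fun=> 0 : R[i]).
  exact: primitiveC_L2 (primitiveC_cst _ _ 0).
have [dv [e1 e2 e3]] := sol_in_H_resolvent hP h0 vP.
exists (sol_in_H P lam v); split => //; last first.
- split.
  + by apply: ae_imply e1 => x xE /xE /eqP; rewrite subr_eq0 eq_sym => /eqP.
  + by move: e2 => /= /eqP; rewrite subr_eq0 eq_sym => /eqP.
  + by move: e3 => /= /eqP; rewrite subr_eq0 eq_sym => /eqP.
move=> [/= v0 _ _].
have {}v0 : eqae `]0, b[ v (fun=> 0).
  apply: ae_imply v0 => x xE xb; apply: xE; move: xb; rewrite /= !in_itv /= => /andP[x0 xb].
  by rewrite xb (lt_trans Na0).
have [w [v1 v2]] := W2_jet (let: And5 _ (conj vW _) _ _ _ := vP in vW).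
have v00 := primitiveC_ae0 v1 v0.
have v1' : primitiveC 0 b v (fun=> 0).
  by apply: primitiveC_eq (primitiveC_cst _ _ 0) => // x /v00.
have v'0 x : 0 < x < b -> cderiv v x = 0.
  by move=> xb; have [_ _] := primitiveC_cderiv xb v1' (primitiveC_cst _ _ 0).
have Lv : limm v b = 0.
  by apply: limmE; apply: (cvgC_eq_left b0 _ (cvgC_cst 0)) => x /v00.
have Lv' : limm (cderiv v) b = 0.
  by apply: limmE; apply: (cvgC_eq_left b0 _ (cvgC_cst 0)) => x /v'0.
have := cos2Dsin2 (bcr P).
move: vb v'b; rewrite Lv Lv' => -[<-] [<-].
by rewrite expr0n addr0 => /esym/eqP; rewrite oner_eq0.
Qed.

Lemma hom_sol_inhom lam s t y : hom_sol q lam s t y -> inhom_sol P lam s t (fun=> 0) y.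
Proof.
move=> [yW yE]; split => //; apply: ae_imply yE => x xE /xE ->.
exact: subrr.
Qed.

Section regular.
Variables (lam : R[i]) (u v : R -> R[i]).
Hypotheses (nm : ~ mu_pole P lam) (nn : ~ nu_pole P lam)
  (hu : is_u P lam u) (hv : is_v P lam v).

Let um : hom_sol q lam (- a) 0 u. Proof. by case: hu. Qed.
Let up : hom_sol q lam 0 b u. Proof. by case: hu. Qed.
Let vm : hom_sol q lam (- a) 0 v. Proof. by case: hv. Qed.
Let vp : hom_sol q lam 0 b v. Proof. by case: hv. Qed.
Let uT : transfers lam u. Proof. by case: hu => _ _ _ _ /transferP. Qed.
Let vT : transfers lam v. Proof. exact: is_v_transfers. Qed.

Lemma wronskian_at_minus x : - a < x < 0 -> wronskian_at u v x = wronskian u v.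
Proof. exact: wronskian_at_limm um vm _. Qed.

(** The transfer matrix preserves the Wronskian, its determinant being 1. *)
Lemma wronskian_at_plus x : 0 < x < b -> wronskian_at u v x = wronskian u v.
Proof.
move=> xb; rewrite (wronskian_at_limp up vp xb) /wronskian.
have [-> ->] := uT; have [-> ->] := vT.
move: (limm u 0) (limm v 0) (limm (cderiv u) 0) (limm (cderiv v) 0) => ? ? ? ?.
by ring.
Qed.

(** The Wronskian at -a is sin(bcl) v'(-a) - cos(bcl) v(-a).  If it vanishes,
    v fulfils the left boundary condition too and is an eigenfunction. *)
Lemma wronskian_neq0 : ~ eigenvalueL P lam -> wronskian u v != 0.
Proof.
move=> ne; apply/eqP => W0; apply: ne.
have [_ vb v'b _ _] := hv; have [_ ua u'a _ _] := hu.
apply: (@eigen_bvp lam v) => //; split.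
- exact: hom_sol_inhom.
- exact: hom_sol_inhom.
- have xin : - a < - a / 2 < 0 by have := Na0; lra.
  have := wronskian_at_limp um vm xin; rewrite wronskian_at_minus // W0 ua u'a => /esym/eqP.
  by rewrite subr_eq0 => /eqP E; rewrite /bc_left mulrC -E mulrC.
- by rewrite /bc_right vb v'b mulrC.
- exact: transfers_interface_conditions.
Qed.

Variables (h : R -> R[i]).
Hypothesis hL : L2 `](- a), b[ h.
Hypothesis W0 : wronskian u v != 0.
Let k := (wronskian u v)^-1.

Let hm : integrableC `](- a), 0[ h.
Proof.
apply: L2_integrable; apply: L2S hL => //.
by apply: subset_itvl; rewrite bnd_simp ltW.
Qed.

Let hp : integrableC `]0, b[ h.
Proof.
apply: L2_integrable; apply: L2S hL => //.
by apply: subset_itvr; rewrite bnd_simp ltW.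
Qed.

Let Au := intC `](- a), 0[ (fun r => h r * u r).
Let Bv := intC `]0, b[ (fun r => h r * v r).

Lemma varparam_inhom_sol g A B s t : s < t -> hom_sol q lam s t u -> hom_sol q lam s t v ->
  integrableC `]s, t[ h ->
  (forall x, s < x < t -> wronskian_at u v x = wronskian u v) ->
  (forall x, s < x < t -> g x = varparam u v h k A B s t x) ->
  [/\ inhom_sol P lam s t h g,
     limp g s = k * (limp v s * A + limp u s * (B + intC `]s, t[ (fun r => h r * v r))) /\
     limp (cderiv g) s = k * (limp (cderiv v) s * A +
       limp (cderiv u) s * (B + intC `]s, t[ (fun r => h r * v r))) &
     limm g t = k * (limm v t * (A + intC `]s, t[ (fun r => h r * u r)) + limm u t * B) /\
     limm (cderiv g) t = k * (limm (cderiv v) t * (A + intC `]s, t[ (fun r => h r * u r))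
         + limm (cderiv u) t * B)].
Proof.
move=> st us vs hi Wst gE.
have kW x : s < x < t -> k * wronskian_at u v x = 1.
  by move=> /Wst ->; rewrite mulVf.
have [w [J1 J2] wE] := varparam_jet A B us vs hi kW.
have J : jet2 s t g (varparam' u v h k A B s t) w.
  by split => //; apply: primitiveC_eq J1 => // x /gE.
have g'E := jet_cderiv J.
have [L1 L2] := varparam_limp k A B st us vs hi.
have [M1 M2] := varparam_limm k A B st us vs hi.
split; last 2 first.
- split; apply: limpE.
    by apply: (cvgC_eq_right st _ L1) => x /gE.
  by apply: (cvgC_eq_right st _ L2) => x /g'E.
- split; apply: limmE.
    by apply: (cvgC_eq_left st _ M1) => x /gE.
  by apply: (cvgC_eq_left st _ M2) => x /g'E.
- split; first exact: jet_W2 J.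
  apply: ae_imply2 wE (jet_ell q J) => x wx Jx xst.
  by rewrite -(wx xst) (Jx xst) (gE _ xst).
Qed.

(** At -a and b one of the two terms of [varparam] vanishes, so g has there the jet
    of a multiple of u, resp. v.  At 0 the coefficients of u and v are the same
    on both sides, so g inherits the transfer relation from u and v. *)
Lemma varparam_bvp g :
  (forall x, - a < x < 0 -> g x = varparam u v h k 0 Bv (- a) 0 x) ->
  (forall x, 0 < x < b -> g x = varparam u v h k Au 0 0 b x) ->
  bvp P lam h g.
Proof.
move=> gm gp.
have [im [m1 m2] [m3 m4]] := varparam_inhom_sol Na0 um vm hm wronskian_at_minus gm.
have [ip [p1 p2] [p3 p4]] := varparam_inhom_sol b0 up vp hp wronskian_at_plus gp.
have [_ vb v'b _ _] := hv; have [_ ua u'a _ _] := hu.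
split => //.
- rewrite /bc_left m1 m2 ua u'a !mulr0 !add0r.
  by move: (Bv + _) => ?; ring.
- rewrite /bc_right p3 p4 vb v'b !mulr0 !addr0.
  by move: (Au + _) => ?; ring.
- apply: (transfers_interface_conditions nm nn); rewrite /transfers p1 p2 m3 m4.
  have [-> ->] := uT; have [-> ->] := vT; rewrite !add0r -/Au -/Bv.
  move: (limm u 0) (limm v 0) (limm (cderiv u) 0) (limm (cderiv v) 0) Au Bv k.
  by move=> ? ? ? ? ? ? ?; split; ring.
Qed.

(** The integral over ]-a, b[ is cut at x and at 0, the points where G(x, .) is
    not given by a product formula. *)
Lemma greenop_varparam G :
  (forall x t, punctured P x -> punctured P t ->
         (x < t -> G x t = u x * v t / wronskian u v) /\
         (t < x -> G x t = u t * v x / wronskian u v)) ->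
  (forall x, - a < x < 0 ->
     greenop P G h x = varparam u v h k 0 Bv (- a) 0 x) /\
  (forall x, 0 < x < b -> greenop P G h x = varparam u v h k Au 0 0 b x).
Proof.
move=> GE.
have um_i := solution_integrable hm um; have vm_i := solution_integrable hm vm.
have up_i := solution_integrable hp up; have vp_i := solution_integrable hp vp.
have pm r : - a < r < 0 -> punctured P r by left.
have pp r : 0 < r < b -> punctured P r by right.
have Gl x r : punctured P x -> punctured P r -> r < x ->
    G x r * h r = (k * v x) * (h r * u r).
  move=> xP rP rx; rewrite ((GE x r xP rP).2 rx) /k.
  by move: (_^-1) => ?; ring.
have Gr x r : punctured P x -> punctured P r -> x < r ->
    G x r * h r = (k * u x) * (h r * v r).
  move=> xP rP xr; rewrite ((GE x r xP rP).1 xr) /k.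
  by move: (_^-1) => ?; ring.
split=> x /[dup] xst /andP[x1 x2].
- have K1 r : - a < r < x -> G x r * h r = (k * v x) * (h r * u r).
    move=> /andP[r1 r2]; apply: (Gl _ _ (pm _ xst) (pm _ _) r2).
    by rewrite r1 (lt_trans r2 x2).
  have K2 r : x < r < 0 -> G x r * h r = (k * u x) * (h r * v r).
    move=> /andP[r1 r2]; apply: (Gr _ _ (pm _ xst) (pm _ _) r1).
    by rewrite r2 (lt_trans x1 r1).
  have K3 r : 0 < r < b -> G x r * h r = (k * u x) * (h r * v r).
    move=> /[dup] rb /andP[r1 r2].
    exact: (Gr _ _ (pm _ xst) (pp _ rb) (lt_trans x2 r1)).
  have i1 : integrableC `](- a), x[ (fun r => h r * u r).
    by apply: integrableCS um_i => //; apply: subset_itvl; rewrite bnd_simp ltW.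
  have i2 : integrableC `]x, 0[ (fun r => h r * v r).
    by apply: integrableCS vm_i => //; apply: subset_itvr; rewrite bnd_simp ltW.
  have [I1 E1] := intC_kernel K1 i1.
  have [I2 E2] := intC_kernel K2 i2.
  have [I3 E3] := intC_kernel K3 vp_i.
  rewrite /greenop (intC_glue Na0 b0 _ I3); last exact: integrableC_glue I1 I2.
  rewrite (intC_glue x1 x2 I1 I2) E1 E2 E3 /varparam -/Bv.
  move: (intC `](- a), x[ _) (intC `]x, 0[ _) Bv k (u x) (v x) => ? ? ? ? ? ?; ring.
- have K1 r : - a < r < 0 -> G x r * h r = (k * v x) * (h r * u r).
    move=> /[dup] rb /andP[r1 r2].
    exact: (Gl _ _ (pp _ xst) (pm _ rb) (lt_trans r2 x1)).
  have K2 r : 0 < r < x -> G x r * h r = (k * v x) * (h r * u r).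
    move=> /andP[r1 r2]; apply: (Gl _ _ (pp _ xst) (pp _ _) r2).
    by rewrite r1 (lt_trans r2 x2).
  have K3 r : x < r < b -> G x r * h r = (k * u x) * (h r * v r).
    move=> /andP[r1 r2]; apply: (Gr _ _ (pp _ xst) (pp _ _) r1).
    by rewrite r2 (lt_trans x1 r1).
  have i2 : integrableC `]0, x[ (fun r => h r * u r).
    by apply: integrableCS up_i => //; apply: subset_itvl; rewrite bnd_simp ltW.
  have i3 : integrableC `]x, b[ (fun r => h r * v r).
    by apply: integrableCS vp_i => //; apply: subset_itvr; rewrite bnd_simp ltW.
  have [I1 E1] := intC_kernel K1 um_i.
  have [I2 E2] := intC_kernel K2 i2.
  have [I3 E3] := intC_kernel K3 i3.
  rewrite /greenop (intC_glue Na0 b0 I1); last exact: integrableC_glue I2 I3.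
  rewrite (intC_glue x1 x2 I2 I3) E1 E2 E3 /varparam -/Au.
  move: (intC `]0, x[ _) (intC `]x, b[ _) Au k (u x) (v x) => ? ? ? ? ? ?; ring.
Qed.

End regular.

Section pole.
Variables (lam : R[i]) (gm gp G : R -> R -> R[i]) (h : R -> R[i]).
Hypotheses (pole : mu_pole P lam \/ nu_pole P lam)
  (Gm : is_green_kernel P lam (- a) 0 (bc_minus P lam) gm)
  (Gp : is_green_kernel P lam 0 b (bc_plus P lam) gp)
  (GE : forall x t, punctured P x -> punctured P t ->
         G x t = if (x < 0) && (t < 0) then gm x t
                 else if (0 < x) && (0 < t) then gp x t else 0)
  (hL : L2 `](- a), b[ h).

(** Limits and derivatives on ]s, t[ do not see values outside ]s, t[. *)
Lemma inhom_sol_eq s t g1 g2 : s < t -> inhom_sol P lam s t h g1 ->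
  (forall x, s < x < t -> g1 x = g2 x) ->
  [/\ inhom_sol P lam s t h g2, limp g2 s = limp g1 s,
     limp (cderiv g2) s = limp (cderiv g1) s, limm g2 t = limm g1 t
   & limm (cderiv g2) t = limm (cderiv g1) t].
Proof.
move=> st [/W2_jet[w J] gE] g12; have [J1 J2] := J.
have K : jet2 s t g2 (cderiv g1) w by split => //; exact: primitiveC_eq J1.
have g2' x : s < x < t -> cderiv g1 x = cderiv g2 x.
  by move=> /(jet_cderiv K) ->.
split.
- split; first exact: jet_W2 K.
  have E : {ae mu_L, forall x, (`]s, t[%classic x -> lam * g1 x - ell q g1 x = h x) /\
    (`]s, t[%classic x -> ell q g1 x = - w x + q x * g1 x)}.
    by apply: ae_imply2 gE (jet_ell q J) => x; exact: conj.
  apply: ae_imply2 E (jet_ell q K) => x [e1 e2] e3 xst.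
  by rewrite (e3 xst) -(g12 _ xst) -(e2 xst) (e1 xst).
- exact: limp_eq J1 g12.
- exact: limp_eq J2 g2'.
- exact: limm_eq J1 g12.
- exact: limm_eq J2 g2'.
Qed.

Lemma greenop_minus x : - a < x < 0 ->
  greenop P G h x = intC `](- a), 0[ (fun r => gm x r * h r).
Proof.
move=> /[dup] xa /andP[x1 x2].
have hm : L2 `](- a), 0[ h.
  by apply: L2S hL => //; apply: subset_itvl; rewrite bnd_simp ltW.
have [/(_ _ xa) I _ _ _] := Gm hm.
have K1 r : - a < r < 0 -> G x r * h r = 1 * (gm x r * h r).
  move=> /[dup] ra /andP[r1 r2]; rewrite GE; [|by left|by left].
  by rewrite x2 r2 mul1r.
have K2 r : 0 < r < b -> G x r * h r = 1 * 0.
  move=> /[dup] ra /andP[r1 r2]; rewrite GE; [|by left|by right].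
  by rewrite x2 /= ltNge (ltW r1) /= ltNge (ltW x2) /= mul0r mulr0.
have [I1 E1] := intC_kernel K1 I.
have I0 : integrableC `]0, b[ (fun=> 0 : R[i]) by split; exact: integrable0.
have [I2 E2] := intC_kernel K2 I0.
by rewrite /greenop (intC_glue Na0 b0 I1 I2) E1 E2 !mul1r (@intC_eq0 _ _ (fun=> 0)) ?addr0.
Qed.

Lemma greenop_plus x : 0 < x < b ->
  greenop P G h x = intC `]0, b[ (fun r => gp x r * h r).
Proof.
move=> /[dup] xa /andP[x1 x2].
have hp : L2 `]0, b[ h.
  by apply: L2S hL => //; apply: subset_itvr; rewrite bnd_simp ltW.
have [/(_ _ xa) I _ _ _] := Gp hp.
have K1 r : 0 < r < b -> G x r * h r = 1 * (gp x r * h r).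
  move=> /[dup] ra /andP[r1 r2]; rewrite GE; [|by right|by right].
  by rewrite ltNge (ltW x1) /= x1 r1 mul1r.
have K2 r : - a < r < 0 -> G x r * h r = 1 * 0.
  move=> /[dup] ra /andP[r1 r2]; rewrite GE; [|by right|by left].
  by rewrite ltNge (ltW x1) /= x1 ltNge (ltW r2) /= mul0r mulr0.
have [I1 E1] := intC_kernel K1 I.
have I0 : integrableC `](- a), 0[ (fun=> 0 : R[i]) by split; exact: integrable0.
have [I2 E2] := intC_kernel K2 I0.
by rewrite /greenop (intC_glue Na0 b0 I2 I1) E1 E2 !mul1r (@intC_eq0 _ _ (fun=> 0)) ?add0r.
Qed.

(** At a pole of mu one has g(0^+) = 0, hence Delta g = - g(0^-), and the left
    condition at 0 is the one for nu; at a pole of nu one has g'(0^-) = 0, hence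
    Delta' g = g'(0^+), and the right condition at 0 is the one for mu. *)
Lemma greenop_pole_bvp : bvp P lam h (greenop P G h).
Proof.
have hm : L2 `](- a), 0[ h.
  by apply: L2S hL => //; apply: subset_itvl; rewrite bnd_simp ltW.
have hp : L2 `]0, b[ h.
  by apply: L2S hL => //; apply: subset_itvr; rewrite bnd_simp ltW.
have [_ m1 m2 [m3 m4 m5]] := Gm hm.
have [_ p1 p2 [p3 p4 p5]] := Gp hp.
have Em x : - a < x < 0 -> intC `](- a), 0[ (fun r => gm x r * h r) = greenop P G h x.
  by move=> /greenop_minus.
have Ep x : 0 < x < b -> intC `]0, b[ (fun r => gp x r * h r) = greenop P G h x.
  by move=> /greenop_plus.
have [mi ml ml' mr mr'] := inhom_sol_eq Na0 (conj m1 m2) Em.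
have [pi pl pl' pr pr'] := inhom_sol_eq b0 (conj p1 p2) Ep.
split; [exact: mi|exact: pi|by rewrite /bc_left ml ml'|by rewrite /bc_right pr pr'|].
rewrite /interface_conditions /jump /djump pl pl' mr mr'; split.
- move=> nm; case: pole => [/nm []|np].
  by rewrite (m5 np) subr0 -(p4 nm) mulrC.
- exact: p5.
- move=> nn; case: pole => [mp|/nn []].
  by rewrite (p5 mp) sub0r -(m4 nn) mulrC.
- exact: m5.
Qed.

End pole.

Lemma green_bvp lam G h : ~ eigenvalueL P lam -> is_green P lam G ->
  L2 `](- a), b[ h -> bvp P lam h (greenop P G h).
Proof.
move=> ne [Greg Gpole] hL.
have [p|np] := pselect (mu_pole P lam \/ nu_pole P lam).
  have [gm [gp [Gm Gp GE]]] := Gpole p.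
  exact: (greenop_pole_bvp p Gm Gp GE hL).
have nm : ~ mu_pole P lam by move=> p; apply: np; left.
have nn : ~ nu_pole P lam by move=> p; apply: np; right.
have [u [v [hu hv GE]]] := Greg nm nn.
have W0 := wronskian_neq0 nm nn hu hv ne.
have [gm gp] := greenop_varparam hu hv hL GE.
exact: (varparam_bvp nm nn hu hv hL W0 gm gp).
Qed.

End Green.

(** * The resolvent *)

Theorem theorem6p1 (R : realType) (P : problem R) (hP : standing_assumptions P)
  (lam : R[i]) (hlam : ~ eigenvalueL P lam)
  (G : R -> R -> R[i]) (hG : is_green P lam G)
  (h : R -> R[i]) (hh : L2 (`](- pa P), (pb P)[)%classic h) :
  let g := greenop P G h in
  let f1 := resolvent_vec (node1 P) (weight1 P) lam
    (if 0 < eta P then djump g else limp g 0)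
    (if 0 < eta P then - limp g 0 else djump g) in
  let f2 := resolvent_vec (node2 P) (weight2 P) lam
    (if 0 < kappa P then jump g else limm (cderiv g) 0)
    (if 0 < kappa P then limm (cderiv g) 0 else - jump g) in
  is_resolvent lam ((h, 0, 0) : H P) ((g, f1, f2) : H P).
Proof.
move=> g f1 f2.
have [dY eY] := sol_in_H_resolvent hP hh (green_bvp hP hlam hG hh).
split; [exact: dY|exact: eY|].
by move=> Z dZ eZ; exact: (resolvent_unique hP hlam dY eY dZ eZ).
Qed.
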